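(* Let $\Sigma$ be a finite alphabet and let $W\subset\Sigma^*$ be a set of words with $|W|=4$. If $H_1(\mathcal{C}^B_*[W])\neq 0$, then $\mathcal{C}^B_*[W]$ is isomorphic, via reflection, symbol permutation or affixes, to $\mathcal{C}^B_*[V]$, where, for two distinct symbols $a,b\in\Sigma$, the set $V\subset\{a,b\}^*$ is one of the following: 1. $V_1=\{(ab)^t,\ a(ab)^t,\ (ab)^ta,\ (ab)^{t+1}\}$ for some $t\ge 1$; 2. $V_2=\{(ab)^t,\ a(ab)^t,\ (ab)^tb,\ (ab)^{t+1}\}$ for some $t\ge 2$; 3. $V_3=\{(ab)^t,\ (ab)^ta,\ b(ab)^t,\ (ab)^{t+1}\}$ for some $t\ge 1$; 4. $V_4=\{(ab)^ta,\ b(ab)^ta,\ (ab)^{t+1},\ b(ab)^t\}$ for some $t\ge 0$; 5. $V_5=\{(ab)^{t+1},\ (ab)^{t+1}a,\ b(ab)^{t+1},\ b(ab)^ta\}$ for some $t\ge 0$; 6. $V_6=\{(ab)^{t+1},\ a(ab)^{t+1},\ (ab)^{t+1}b,\ a(ab)^tb\}$ for some $t\ge 1$.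
   Context: $\Sigma^*$ is the set of finite words over $\Sigma$, $1$ denotes the empty word, $x[1]$ is the first symbol of a nonempty word $x$, and $[m]=\{1,\dots,m\}$. Blocks. For $m\ge 0$ an $m$-block is a formal expression $\sigma=x_0(1,a_1)x_1(1,a_2)\cdots x_{m-1}(1,a_m)x_m$ with $x_i\in\Sigma^*$, $a_i\in\Sigma$ (an element of $\Sigma^*\times E\times\Sigma^*\times\dots\times E\times\Sigma^*$ with $m$ factors $E=\{(1,a):a\in\Sigma\}$); $\dim\sigma=m$; $0$-blocks are words. Equivalence of $m$-blocks is defined recursively: $0$-blocks are equivalent iff equal as words; for $m\ge1$, writing $\sigma_i=\hat\sigma_i(1,a_i)x_i$ with $\hat\sigma_i$ an $(m-1)$-block, $a_i\in\Sigma$, $x_i\in\Sigma^*$, one has $\sigma_1\equiv\sigma_2$ iff $\hat\sigma_1a_1x_1\equiv\hat\sigma_2a_2x_2$ and $\hat\sigma_1x_1\equiv\hat\sigma_2x_2$. A block is in canonical form if for every $i=1,\dots,m$ the word $x_i$ is empty or $x_i[1]\ne a_i$; each equivalence class contains exactly one block in canonical form. Blocks are considered up to equivalence (''='' means equivalent). Sub-blocks and vertices. For disjoint $I^+,I^-\subset[m]$, $\sigma(I^+,I^-)=x_0\lambda_1x_1\cdots\lambda_mx_m$ where $\lambda_i=a_i$ if $i\in I^+$, $\lambda_i=1$ if $i\in I^-$, and $\lambda_i=(1,a_i)$ otherwise; it is an $(m-|I^+|-|I^-|)$-block. For $I\subset[m]$, $v_I(\sigma)=\sigma(I,[m]\setminus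 I)\in\Sigma^*$, and $V(\sigma)=\{v_I(\sigma):I\subset[m]\}$. Validity. $\sigma$, with canonical form $x_0(1,a_1)x_1\cdots(1,a_m)x_m$, is valid if for every $i=1,\dots,m-1$ with $x_i=1$ one has $a_i\ne a_{i+1}$. Insertion Chain Complex. For $W\subset\Sigma^*$, let $\mathcal{C}^B[W]$ be the set of all valid blocks $\sigma$ with $V(\sigma)\subset W$. The chain complex $\mathcal{C}^B_*[W]$ has as $k$-th chain group the free abelian group on the $k$-dimensional elements of $\mathcal{C}^B[W]$, with boundary $\partial\sigma=\sum_{i=1}^m(-1)^{i+1}\left[\overline F_i(\sigma)-\underline F_i(\sigma)\right]$ for a valid $m$-block with $m\ge1$, where $\overline F_i(\sigma)=\sigma(\{i\},\emptyset)$, and $\underline F_i(\sigma)=\sigma(\emptyset,\{i\})$ if this is a valid block and $\underline F_i(\sigma)=0$ otherwise; $\partial=0$ on $0$-blocks. Homology has $\mathbb{Z}$ coefficients. ''Isomorphic via reflection, symbol permutation or affixes'' means that the isomorphism is induced by a bijection $W\to V$ of word sets that is a composition of maps (and inverses of maps) of the following types: reversal $x\mapsto x^R$ of all words; applying a permutation of $\Sigma$ to every symbol of every word; adding fixed affixes $x\mapsto w_0xw_1$ with $w_0,w_1\in\Sigma^*$. *)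

(* Defs.v *)
From HB Require Import structures.
From mathcomp Require Import all_boot all_order all_fingroup all_algebra.
From mathcomp Require Import finmap.
From mathcomp.multinomials Require Import monalg.

Set Implicit Arguments.
Unset Strict Implicit.
Unset Printing Implicit Defensive.

Import GRing.Theory.

Section Blocks.

Variable Sigma : finType.

Notation word := (seq Sigma).

(* x_0 (1,a_1) x_1 ... (1,a_m) x_m is encoded as
   (x_0, [:: (a_1, x_1); ...; (a_m, x_m)]).
   The positions 1, ..., m of the insertions are numbered from 0 below. *)
Definition block : Type := word * seq (Sigma * word).

Implicit Types (w : word) (s t : block).

Definition dim s : nat := size s.2.

Definition word_block w : block := (w, [::]).

Definition prepend w s : block := (w ++ s.1, s.2).

Definition holds_at (m : nat) (I : {set 'I_m}) (i : nat) : bool :=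
  [exists j in I, val j == i].

Fixpoint subblock_tail m (Ip Im : {set 'I_m}) (i : nat)
    (l : seq (Sigma * word)) : block :=
  if l is (a, x) :: l' then
    let r := prepend x (subblock_tail Ip Im i.+1 l') in
    if holds_at Ip i then prepend [:: a] r
    else if holds_at Im i then r
    else ([::], (a, r.1) :: r.2)
  else word_block [::].

(* sigma(I^+, I^-), meant for m = dim s and disjoint Ip, Im. *)
Definition subblock m (Ip Im : {set 'I_m}) s : block :=
  prepend s.1 (subblock_tail Ip Im 0 s.2).

(* v_I(sigma); for m = dim s the sub-block below is a 0-block. *)
Definition vertex m (I : {set 'I_m}) s : word := (subblock I (~: I) s).1.

(* For s = s' (1,a) x of dimension m.+1, the sub-blocks at ord_max are
   s' a x and s' x. *)
Fixpoint equiv_at (m : nat) s t : bool :=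
  if m is m'.+1 then
    let last := [set @ord_max m'] in
    equiv_at m' (subblock last set0 s) (subblock last set0 t)
    && equiv_at m' (subblock set0 last s) (subblock set0 last t)
  else s.1 == t.1.

Definition block_equiv s t : bool := (dim s == dim t) && equiv_at (dim s) s t.

Definition canonical s : bool :=
  all (fun p : Sigma * word => ohead p.2 != Some p.1) s.2.

(* From right to left, the maximal power of a at the start of x is moved
   across (1,a), using (1,a) a = a (1,a). *)
Fixpoint canon_tail (l : seq (Sigma * word)) : block :=
  if l is (a, x) :: l' then
    let r := prepend x (canon_tail l') in
    let k := find (predC1 a) r.1 in
    (take k r.1, (a, drop k r.1) :: r.2)
  else word_block [::].

Definition canon s : block := prepend s.1 (canon_tail s.2).

Definition valid s : bool :=
  sorted (fun p q : Sigma * word => (p.2 == [::]) ==> (p.1 != q.1))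
         (canon s).2.

Lemma dim_canon s : dim (canon s) = dim s.
Proof.
case: s => x0 l; rewrite /dim /canon /=.
by elim: l => [|[a x] l IHl] //=; rewrite IHl.
Qed.

Lemma canon_canonical s : canonical (canon s).
Proof.
case: s => x0 l; rewrite /canonical /canon /=.
elim: l => [|[a x] l IHl] //=; rewrite IHl andbT.
set r := x ++ _; elim: r => [|b r IHr] //=.
by case: (eqVneq b a) => [->|nba] //=; apply/eqP => -[/eqP]; apply/negP.
Qed.

(* The word obtained by keeping the inserted symbols at the positions in P,
   counted from i. *)
Fixpoint vertex_tail (P : pred nat) (i : nat) (l : seq (Sigma * word)) : word :=
  if l is (a, x) :: l' then
    (if P i then [:: a] else [::]) ++ x ++ vertex_tail P i.+1 l'
  else [::].

Definition eval (P : pred nat) (i : nat) s : word := s.1 ++ vertex_tail P i s.2.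

Lemma eq_vertex_tail (P Q : pred nat) i l :
  (forall j, i <= j -> j < i + size l -> P j = Q j) ->
  vertex_tail P i l = vertex_tail Q i l.
Proof.
elim: l i => [|[a x] l IHl] i PQ //=.
rewrite PQ // ?addnS ?ltnS ?leq_addr //; congr (_ ++ (_ ++ _)).
by apply: IHl => j ij jl; apply: PQ; [exact: ltnW | rewrite addnS -addSn].
Qed.

Lemma holds_atE m (I : {set 'I_m}) (j : 'I_m) : holds_at I j = (j \in I).
Proof.
apply/existsP/idP => [[k /andP[kI /eqP kj]]|jI]; last by exists j; rewrite jI /=.
by rewrite (val_inj kj) in kI.
Qed.

Lemma holds_atC m (I : {set 'I_m}) i :
  i < m -> holds_at (~: I) i = ~~ holds_at I i.
Proof. by move=> im; rewrite !(holds_atE _ (Ordinal im)) inE. Qed.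

Lemma holds_at0 m i : holds_at (set0 : {set 'I_m}) i = false.
Proof. by apply/existsP => -[k]; rewrite inE. Qed.

Lemma holds_at_max m i : holds_at [set @ord_max m] i = (i == m).
Proof.
apply/existsP/eqP => [[k]|->]; last by exists ord_max; rewrite inE !eqxx.
by rewrite inE => /andP[/eqP-> /eqP<-].
Qed.

Lemma vertexE m (I : {set 'I_m}) s :
  dim s = m -> vertex I s = eval (holds_at I) 0 s.
Proof.
case: s => x0 l; rewrite /dim /vertex /eval /subblock /= => szl.
congr (_ ++ _); have: 0 + size l <= m by rewrite szl.
elim: l 0 {szl} => [|[a x] l IHl] i //=; rewrite addnS -addSn => il.
rewrite -(IHl i.+1 il) holds_atC; first by case: (holds_at I i).
by rewrite (leq_trans _ il) // addSn ltnS leq_addr.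
Qed.

Lemma eval_subblock_max (b : bool) m (P : pred nat) s :
  let last := [set @ord_max m] in
  let t := subblock (if b then last else set0) (if b then set0 else last) s in
  dim s = m.+1 ->
  dim t = m /\
  eval P 0 t = eval (fun j => if j == m then b else P j) 0 s.
Proof.
case: s => x0 l /=; rewrite /dim /=.
set A := if b then _ else _; set B := if b then _ else _.
set Q := fun j => _.
have HA j : holds_at A j = b && (j == m).
  by rewrite /A; case: (b); rewrite ?holds_at0 ?holds_at_max.
have HB j : holds_at B j = ~~ b && (j == m).
  by rewrite /B; case: (b); rewrite ?holds_at0 ?holds_at_max.
rewrite -[size l]add0n.
suff main i : i <= m -> i + size l = m.+1 ->
    (size (subblock_tail A B i l).2).+1 = size l /\
    eval P i (subblock_tail A B i l) = vertex_tail Q i l.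
  move=> szl; have [sz ev] := main 0 (leq0n m) szl.
  split; first by apply: succn_inj; rewrite /= sz -szl.
  by rewrite {1}/eval /= -catA -/(eval _ _ _) ev.
elim: l i => [|[a x] l IHl] i im.
  by rewrite addn0 => eim; rewrite eim ltnn in im.
rewrite addnS => -[il]; rewrite [subblock_tail _ _ _ _]/= HA HB.
case: (eqVneq i m) => [eim|nim].
  have -> : l = [::] by apply/nilP; rewrite /nilp -(eqn_add2l m) -{1}eim il addn0.
  by rewrite !andbT /= /eval /Q eim eqxx; case: (b); rewrite /= !cats0.
rewrite !andbF /=.
have ltim : i < m by rewrite ltn_neqAle nim.
have [|sz ev] := IHl i.+1 ltim; first by rewrite addSn il.
split; first by rewrite /= sz.
by rewrite -ev /eval /= /Q (negPf nim) -!catA.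
Qed.

Lemma equiv_atP m s t : dim s = m -> dim t = m ->
  equiv_at m s t <-> (forall P : pred nat, eval P 0 s = eval P 0 t).
Proof.
elim: m s t => [|m IHm] s t ds dt.
  case: s ds => x l /size0nil /= ->; case: t dt => y k /size0nil /= ->.
  rewrite /eval /= !cats0; split=> [/eqP //|/(_ predT)->//].
have [[dsT _] [dtT _]] := (@eval_subblock_max true m predT s ds,
                           @eval_subblock_max true m predT t dt).
have [[dsF _] [dtF _]] := (@eval_subblock_max false m predT s ds,
                           @eval_subblock_max false m predT t dt).
split=> [/= /andP[/(IHm _ _ dsT dtT) ET /(IHm _ _ dsF dtF) EF] P|E].
  have split_P r : dim r = m.+1 -> eval P 0 r =
      eval (fun j => if j == m then P m else P j) 0 r.
    by move=> _; congr (_ ++ _); apply: eq_vertex_tail => j _ _; case: eqP => // ->.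
  rewrite !split_P //.
  case: (P m).
    by rewrite -(@eval_subblock_max true m P s ds).2
               -(@eval_subblock_max true m P t dt).2.
  by rewrite -(@eval_subblock_max false m P s ds).2
             -(@eval_subblock_max false m P t dt).2.
rewrite /=; apply/andP; split.
  apply/(IHm _ _ dsT dtT) => P.
  by rewrite (@eval_subblock_max true m P s ds).2
             (@eval_subblock_max true m P t dt).2.
apply/(IHm _ _ dsF dtF) => P.
by rewrite (@eval_subblock_max false m P s ds).2
           (@eval_subblock_max false m P t dt).2.
Qed.

Lemma block_equivP s t :
  block_equiv s t <->
  dim s = dim t /\ forall I : {set 'I_(dim s)}, vertex I s = vertex I t.
Proof.
rewrite /block_equiv; split=> [/andP[/eqP dst]|[dst E]].
  move=> /(equiv_atP erefl (esym dst)) E; split=> // I.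
  by rewrite !vertexE.
rewrite dst eqxx -dst; apply/(equiv_atP erefl (esym dst)) => P.
have eI r : dim r = dim s ->
    eval P 0 r = vertex [set j : 'I_(dim s) | P j] r.
  move=> dr; rewrite vertexE //; congr (_ ++ _); apply: eq_vertex_tail => j _.
  rewrite add0n -/(dim r) dr => js.
  by rewrite (holds_atE _ (Ordinal js)) inE.
by rewrite !eI.
Qed.

Lemma canon_equiv s : block_equiv (canon s) s.
Proof.
rewrite /block_equiv dim_canon eqxx.
apply/(equiv_atP (dim_canon s) erefl) => P.
case: s => x0 l; rewrite /eval /canon /= -catA; congr (_ ++ _).
elim: l 0 => [|[a x] l IHl] i //=; rewrite -{}IHl.
set r := prepend x (canon_tail l); set v := vertex_tail _ _ _.
have -> : x ++ (canon_tail l).1 ++ v = r.1 ++ v by rewrite /= catA.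
set k := find _ _; rewrite -[in RHS](cat_take_drop k r.1) -!catA.
case: (P i) => //=; rewrite {}/k {r}; move: v (x ++ _) => v w.
elim: w => [|b w IHw] //=; case: (eqVneq b a) => [->|_] /=; last by [].
by congr (_ :: _).
Qed.

Lemma canonical_eval_inj n s t i : canonical s -> canonical t ->
  dim s = n -> dim t = n ->
  (forall P : pred nat, eval P i s = eval P i t) -> s = t.
Proof.
elim: n i s t => [|n IHn] i s t.
  case: s t => [x l] [y k] _ _ /size0nil /= -> /size0nil /= -> /(_ predT).
  by rewrite /eval /= !cats0 => ->.
case: s t => [x0 [|[a x] l]] [y0 [|[b y] k]] //= cs ct [dl] [dk] E.
have E1 (c : bool) (P : pred nat) :
    x0 ++ (if c then [:: a] else [::]) ++ eval P i.+1 (x, l) =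
    y0 ++ (if c then [:: b] else [::]) ++ eval P i.+1 (y, k).
  have := E (fun j => if j == i then c else P j); rewrite /eval /= eqxx.
  have e z := @eq_vertex_tail (fun j => if j == i then c else P j) P i.+1 z.
  by rewrite !e // => j ij _; rewrite gtn_eqF.
move: {E} E1 cs ct dl dk.
wlog le_xy : a b x y x0 y0 l k / size x0 <= size y0.
  move=> W E cs ct dl dk; have [le_xy|/ltnW le_yx] := leqP (size x0) (size y0).
    exact: W.
  by apply/esym/W => // c P; rewrite E.
move=> E /andP[/= ax cl] /andP[/= _ ck] dl dk.
have [z ey0] : exists z, y0 = x0 ++ z.
  exists (drop (size x0) y0); rewrite -{1}(cat_take_drop (size x0) y0).
  have /(congr1 (take (size x0))) := E false predT.
  by rewrite take_size_cat // takel_cat // => <-.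
subst y0.
have E' c P := congr1 (drop (size x0)) (E c P).
have {E E'} E (c : bool) (P : pred nat) :
    (if c then [:: a] else [::]) ++ eval P i.+1 (x, l) =
    z ++ (if c then [:: b] else [::]) ++ eval P i.+1 (y, k).
  by have := E' c P; rewrite -catA !drop_size_cat.
have e : (x, l) = prepend z (y, k).
  by apply: (IHn i.+1) => // P; have := E false P; rewrite /eval /= catA.
case: z e E {le_xy} => [|c z] [ex el] E.
  by rewrite ex el cats0; have [->] := E true predT.
have [eac] := E true predT.
by rewrite ex eac eqxx in ax.
Qed.

Lemma canonical_uniq s t :
  canonical s -> canonical t -> block_equiv s t -> s = t.
Proof.
move=> cs ct /andP[/eqP dst /(equiv_atP erefl (esym dst))].
exact: canonical_eval_inj.
Qed.

Lemma canon_id s : canonical s -> canon s = s.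
Proof.
move=> cs; apply: canonical_uniq cs (canon_equiv s); exact: canon_canonical.
Qed.

Lemma canon_eqP s t : canon s = canon t <-> block_equiv s t.
Proof.
have eq_eval u v : block_equiv u v <->
    dim u = dim v /\ forall P : pred nat, eval P 0 u = eval P 0 v.
  rewrite /block_equiv; split=> [/andP[/eqP duv]|[duv E]].
    by move=> /(equiv_atP erefl (esym duv)).
  by rewrite duv eqxx -duv; apply/(equiv_atP erefl (esym duv)).
have /eq_eval[ds Es] := canon_equiv s; have /eq_eval[dt Et] := canon_equiv t.
split=> [E|/eq_eval[dst Est]].
  by apply/eq_eval; rewrite -ds -dt E; split=> // P; rewrite -Es -Et E.
apply: canonical_uniq; try exact: canon_canonical.
by apply/eq_eval; rewrite ds dt; split=> // P; rewrite Es Et.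
Qed.
(* Membership in C^B[W]; each equivalence class of blocks is represented by its
   canonical element, see canon_canonical, canon_equiv and canonical_uniq. *)
Definition in_CB (W : {pred word}) s : Prop :=
  [/\ canonical s, valid s &
      forall I : {set 'I_(dim s)}, vertex I s \in W].

Local Open Scope ring_scope.

Definition chain := {malg int[block]}.

Definition gen s : chain := << canon s >>.

Definition is_chain (W : {pred word}) (k : nat) (z : chain) : Prop :=
  forall s, s \in msupp z -> in_CB W s /\ dim s = k.

Definition upper_face s (i : 'I_(dim s)) : chain :=
  gen (subblock [set i] set0 s).

Definition lower_face s (i : 'I_(dim s)) : chain :=
  let t := subblock set0 [set i] s in if valid t then gen t else 0.

(* The sign (-1)^(i+1) for i = 1, ..., m is (-1)^i for i = 0, ..., m-1. *)
Definition boundary_block s : chain :=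
  \sum_(i < dim s) (-1) ^+ i *: (upper_face i - lower_face i).

Definition boundary (z : chain) : chain :=
  \sum_(s <- msupp z) z@_s *: boundary_block s.

Definition homology_is_zero (W : {pred word}) (k : nat) : Prop :=
  forall z, is_chain W k z -> boundary z = 0 ->
  exists2 c, is_chain W k.+1 c & boundary c = z.

Inductive elementary : (word -> word) -> Prop :=
| elem_reversal : elementary rev
| elem_permutation (p : {perm Sigma}) : elementary (map p)
| elem_affixes (w0 w1 : word) : elementary (fun x => w0 ++ x ++ w1).

(* word_bijection W V f: the restriction of f is a bijection from W to V that is
   a composition of elementary maps and of inverses of elementary maps, each
   restricted to the set reached so far. *)
Inductive word_bijection (W : {fset word}) :
    {fset word} -> (word -> word) -> Prop :=
| word_bij_id : word_bijection W W id
| word_bij_elem V f e :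
    elementary e -> word_bijection W V f ->
    word_bijection W [fset e x | x in V]%fset (e \o f)
| word_bij_inv V f e e' :
    elementary e -> word_bijection W [fset e x | x in V]%fset f ->
    {in V, cancel e e'} ->
    word_bijection W V (e' \o f).

Definition chain_isomorphism (W V : {pred word})
    (Phi : {additive chain -> chain}) : Prop :=
  [/\ forall k z, is_chain W k z ->
        is_chain V k (Phi z) /\ Phi (boundary z) = boundary (Phi z),
      forall k z, is_chain W k z -> Phi z = 0 -> z = 0 &
      forall k y, is_chain V k y -> exists2 z, is_chain W k z & Phi z = y].

(* Phi is induced by f: it sends a block to the block whose vertices are the
   images under f, where the insertions may be renumbered by a permutation pi
   (reversal reverses their order), and then the orientation changes by the
   sign of pi. A block is determined up to equivalence by its indexed vertices,
   see block_equivP. *)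
Definition induced_by (W V : {pred word}) (f : word -> word)
    (Phi : chain -> chain) : Prop :=
  forall s, in_CB W s ->
  exists (pi : {perm 'I_(dim s)}) (t : block),
    [/\ in_CB V t, dim t = dim s,
        forall I : {set 'I_(dim s)}, vertex I t = f (vertex (pi @: I) s) &
        Phi (gen s) = (-1) ^+ odd_perm pi *: gen t].

Definition isomorphic_via_words (W V : {fset word}) : Prop :=
  exists f : word -> word, word_bijection W V f /\
  exists Phi : {additive chain -> chain},
    chain_isomorphism (mem W) (mem V) Phi /\ induced_by (mem W) (mem V) f Phi.

End Blocks.

Section Words.

Variables (Sigma : finType) (a b : Sigma).

Definition ab_pow (t : nat) : seq Sigma := flatten (nseq t [:: a; b]).

Local Open Scope fset_scope.

Definition V1 t : {fset seq Sigma} :=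
  [fset ab_pow t; a :: ab_pow t; ab_pow t ++ [:: a]; ab_pow t.+1].
Definition V2 t : {fset seq Sigma} :=
  [fset ab_pow t; a :: ab_pow t; ab_pow t ++ [:: b]; ab_pow t.+1].
Definition V3 t : {fset seq Sigma} :=
  [fset ab_pow t; ab_pow t ++ [:: a]; b :: ab_pow t; ab_pow t.+1].
Definition V4 t : {fset seq Sigma} :=
  [fset ab_pow t ++ [:: a]; b :: ab_pow t ++ [:: a]; ab_pow t.+1;
        b :: ab_pow t].
Definition V5 t : {fset seq Sigma} :=
  [fset ab_pow t.+1; ab_pow t.+1 ++ [:: a]; b :: ab_pow t.+1;
        b :: ab_pow t ++ [:: a]].
Definition V6 t : {fset seq Sigma} :=
  [fset ab_pow t.+1; a :: ab_pow t.+1; ab_pow t.+1 ++ [:: b];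
        a :: ab_pow t ++ [:: b]].

End Words.

(* Main.v *)
Require Import Defs.
From HB Require Import structures.
From mathcomp Require Import all_boot all_order all_fingroup all_algebra.
From mathcomp Require Import finmap.
From mathcomp Require Import zify.
From mathcomp.multinomials Require Import monalg.
From Stdlib Require Import ClassicalEpsilon.
Import Defs.

(** The 1-blocks with vertices in W are the edges of a graph on W that links a
    word to the words obtained from it by one insertion. It is simple, and
    bipartite by the parity of the length. A nonzero 1-cycle is supported on
    edges such that no vertex has degree one, so on four words it is a 4-cycle
    through all of W (four_cycle), which uses every edge there can be
    (full_support). If some valid 2-block has its vertices in W, its boundary is
    such a cycle, and every 1-cycle is a multiple of it (square_homology); hence
    nonzero homology excludes valid 2-blocks.

    What remains is combinatorics of words. By lengths, either x is below y1 and
    y2, which are below z, or y1 and y2 are both below z1 and z2. A common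
    subword or superword at distance one of distinct words y1 and y2 writes
    them, in one of the two orders, as p S d q and p c S q with p and q the longest
    common affixes (common_sub, common_super). If the two common neighbours use
    the same order, then x and z bound a valid 2-block in the first case, and
    z1 = z2 in the second. So both orders occur, which means c' c S = S d d':
    the word S alternates between two letters. The first case then yields V3 or,
    after one letter is put in front, V1; the second yields V4 or V5
    (listed_chain, listed_two_over_two). The families V2 and V6 coincide with
    V3 and V5 up to affixes and the exchange of the two letters.

    Thus W = p U q and V = p' U q' for a common set U, and it remains to compare
    their complexes. A block is determined up to equivalence by its vertices,
    and validity only asks that certain vertices differ (validP). So an
    injective map of words that lifts to blocks induces a chain isomorphism
    (chain_isomorphism_pushforward). Adding affixes lifts at once; removing them
    lifts because all vertices of a valid block can only share a first or last
    letter if an equivalent block carries it outside its insertions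
    (strip_affixes). *)

Set Implicit Arguments.
Unset Strict Implicit.
Unset Printing Implicit Defensive.

Import GRing.Theory.

(** * Words with common neighbours under insertion *)

Section WordCombinatorics.

Variable Sigma : finType.

Notation word := (seq Sigma).

Implicit Types (x y z p q r S : word) (a b c d : Sigma).

Definition inserted x y : Prop :=
  exists p a q, x = p ++ q /\ y = p ++ a :: q.

Lemma size_inserted x y : inserted x y -> size y = (size x).+1.
Proof. by move=> [p [a [q [-> ->]]]]; rewrite !size_cat addnS. Qed.

(** Two words in this position have the common subword p S q and the common
    superword p c S d q; the conditions on head and last make p and q their longest common
    prefix and suffix. *)
Definition span y1 y2 p c S d q : Prop :=
  [/\ y1 = p ++ S ++ d :: q, y2 = p ++ c :: S ++ q,
      head d S != c & last c S != d].

(** If c S starts with c c, or S d ends with d d, then the window between the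
    two insertions shrinks by one letter that the two words share, and neither the
    common subword nor the common superword changes. *)
Lemma span_narrow p c S d q :
  p ++ S ++ d :: q <> p ++ c :: S ++ q ->
  exists p' c' S' d' q',
    [/\ span (p ++ S ++ d :: q) (p ++ c :: S ++ q) p' c' S' d' q',
        p ++ S ++ q = p' ++ S' ++ q' &
        p ++ c :: S ++ d :: q = p' ++ c' :: S' ++ d' :: q'].
Proof.
have [n] := ubnP (size S); elim: n => // n IHn in p c S d q * => szS neq.
have [hS|hS] := eqVneq (head d S) c.
  case: S => [|e S] /= in szS neq hS *; first by rewrite hS in neq.
  rewrite hS in neq *.
  have [||p' [c' [S' [d' [q' H]]]]] := IHn (rcons p c) c S d q.
  - by [].
  - by rewrite !cat_rcons.
  by rewrite !cat_rcons in H; exists p', c', S', d', q'.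
have [lS|lS] := eqVneq (last c S) d; last by exists p, c, S, d, q.
case/lastP: S => [|S e] /= in szS neq hS lS *.
  by rewrite lS eqxx in hS.
rewrite last_rcons in lS; rewrite size_rcons in szS; subst e.
rewrite !cat_rcons in neq *.
exact: IHn.
Qed.

Lemma cat_split p1 q1 p2 q2 : p1 ++ q1 = p2 ++ q2 ->
  (exists r, p2 = p1 ++ r /\ q1 = r ++ q2) \/
  (exists r, p1 = p2 ++ r /\ q2 = r ++ q1).
Proof.
elim: p1 p2 => [|a p1 IHp] [|b p2] /=.
- by left; exists [::].
- by left; exists (b :: p2).
- by move=> <-; right; exists (a :: p1).
case=> <- /IHp[[r [-> ->]]|[r [-> ->]]]; first by left; exists r.
by right; exists r.
Qed.

Lemma common_sub x y1 y2 : y1 <> y2 -> inserted x y1 -> inserted x y2 ->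
  exists p c S d q, x = p ++ S ++ q /\
    (span y1 y2 p c S d q \/ span y2 y1 p c S d q).
Proof.
suff W p1 a1 q1 p2 a2 q2 r :
    p2 = p1 ++ r -> q1 = r ++ q2 -> p1 ++ a1 :: q1 <> p2 ++ a2 :: q2 ->
    exists p c S d q, p1 ++ q1 = p ++ S ++ q /\
      span (p2 ++ a2 :: q2) (p1 ++ a1 :: q1) p c S d q.
  move=> neq [p1 [a1 [q1 [-> ey1]]]] [p2 [a2 [q2 [ex ey2]]]].
  move: neq; rewrite ey1 ey2 => neq.
  have [[r [ep eq]]|[r [ep eq]]] := cat_split ex.
    have [p [c [S [d [q [-> H]]]]]] := W _ a1 _ _ a2 _ _ ep eq neq.
    by exists p, c, S, d, q; split=> //; right.
  have [p [c [S [d [q [e H]]]]]] := W _ a2 _ _ a1 _ _ ep eq (nesym neq).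
  by rewrite ex; exists p, c, S, d, q; split=> //; left.
move=> -> -> neq; have [|p [c [S [d [q [H1 H2 _]]]]]] :=
  @span_narrow p1 a1 r a2 q2.
  by apply/nesym; rewrite catA.
by exists p, c, S, d, q; rewrite -catA; split.
Qed.

Lemma common_super z y1 y2 : y1 <> y2 -> inserted y1 z -> inserted y2 z ->
  exists p c S d q, z = p ++ c :: S ++ d :: q /\
    (span y1 y2 p c S d q \/ span y2 y1 p c S d q).
Proof.
suff W p1 a1 q1 p2 a2 q2 r :
    p2 = p1 ++ r -> a1 :: q1 = r ++ a2 :: q2 -> p1 ++ q1 <> p2 ++ q2 ->
    exists p c S d q, p1 ++ a1 :: q1 = p ++ c :: S ++ d :: q /\
      span (p1 ++ q1) (p2 ++ q2) p c S d q.
  move=> neq [p1 [a1 [q1 [ey1 ->]]]] [p2 [a2 [q2 [ey2 ez]]]].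
  move: neq; rewrite ey1 ey2 => neq.
  have [[r [ep eq]]|[r [ep eq]]] := cat_split ez.
    have [p [c [S [d [q [-> H]]]]]] := W _ _ _ _ _ _ _ ep eq neq.
    by exists p, c, S, d, q; split=> //; left.
  have [p [c [S [d [q [e H]]]]]] := W _ _ _ _ _ _ _ ep eq (nesym neq).
  by rewrite ez; exists p, c, S, d, q; split=> //; right.
move=> ->; case: r => [|e r] /= [-> ->]; first by rewrite cats0.
rewrite -!catA => neq.
have [|p [c [S [d [q [H1 _ H3]]]]]] := @span_narrow p1 e r a2 q2.
  by [].
by exists p, c, S, d, q.
Qed.

(** The common prefix stops at the first disagreement. *)
Lemma common_prefix_uniq p p' X1 X2 X1' X2' :
  p ++ X1 = p' ++ X1' -> p ++ X2 = p' ++ X2' ->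
  ohead X1 != ohead X2 -> ohead X1' != ohead X2' -> p = p'.
Proof.
elim: p p' => [|a p IHp] [|b p'] //=.
- by move=> -> ->; rewrite eqxx.
- by move=> <- <- _; rewrite eqxx.
by case=> -> e1 [e2] n n'; congr (_ :: _); apply: IHp e1 e2 n n'.
Qed.

Lemma span_ohead c S d q :
  head d S != c -> ohead (S ++ d :: q) != ohead (c :: S ++ q).
Proof. by case: S. Qed.

(** Reversed words turn the suffix q into a prefix, so that uniqueness of
    prefixes also gives uniqueness of suffixes. *)
Lemma span_olast p c S d q : last c S != d ->
  [/\ rev (p ++ S ++ d :: q) = rev q ++ d :: rev (p ++ S),
      rev (p ++ c :: S ++ q) = rev q ++ rev (p ++ c :: S) &
      ohead (d :: rev (p ++ S)) != ohead (rev (p ++ c :: S))].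
Proof.
move=> lS; split.
- by rewrite -cat_rcons catA rev_cat -rcons_cat rev_rcons.
- by rewrite -cat_cons catA rev_cat.
by rewrite (lastI c S) -rcons_cat rev_rcons /=; apply: contra lS => /eqP[->].
Qed.

Lemma span_affix_uniq y1 y2 p c S d q p' c' S' d' q' :
  span y1 y2 p c S d q -> span y1 y2 p' c' S' d' q' -> p = p' /\ q = q'.
Proof.
move=> [-> -> h l] [e1 e2 h' l']; split.
  by apply: common_prefix_uniq e1 e2 _ _; apply: span_ohead.
apply: (inv_inj revK).
have [r1 r2 o] := span_olast p q l; have [r1' r2' o'] := span_olast p' q' l'.
move: e1 e2 => /(congr1 rev) + /(congr1 rev).
by rewrite r1 r2 r1' r2' => e1 e2; apply: common_prefix_uniq e1 e2 o o'.
Qed.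

(** p and q depend symmetrically on the two words, although the span itself does
    not: this is what forces alternation below. *)
Lemma span_affix_uniq_swap y1 y2 p c S d q p' c' S' d' q' :
  span y1 y2 p c S d q -> span y2 y1 p' c' S' d' q' -> p = p' /\ q = q'.
Proof.
move=> [-> -> h l] [e2 e1 h' l']; split.
  apply: common_prefix_uniq e1 e2 _ _; first exact: span_ohead.
  by rewrite eq_sym; apply: span_ohead.
apply: (inv_inj revK).
have [r1 r2 o] := span_olast p q l; have [r1' r2' o'] := span_olast p' q' l'.
move: e1 e2 => /(congr1 rev) + /(congr1 rev).
rewrite r1 r2 r1' r2' => e1 e2; apply: common_prefix_uniq e1 e2 o _.
by rewrite eq_sym.
Qed.

Lemma cat_injr p x y : p ++ x = p ++ y -> x = y.
Proof. by elim: p => //= a p IHp [/IHp]. Qed.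

Lemma cat_injl q x y : x ++ q = y ++ q -> x = y.
Proof.
move=> e; have := congr1 size e; rewrite !size_cat => /addIn sz.
by move: e => /eqP; rewrite eqseq_cat // => /andP[/eqP].
Qed.

Lemma span_uniq y1 y2 p c S d q p' c' S' d' q' :
  span y1 y2 p c S d q -> span y1 y2 p' c' S' d' q' ->
  [/\ p = p', c = c', S = S', d = d' & q = q'].
Proof.
move=> H H'; have [ep eq] := span_affix_uniq H H'; subst p' q'.
case: H H' => -> -> _ _ [/cat_injr e /cat_injr[<- /cat_injl eS] _ _].
by move: e; rewrite -eS => /cat_injr[<-].
Qed.

(** S has period two, because the equation shifts it by two letters. *)
Lemma alternating_ends a b S c d : a :: b :: S = S ++ [:: c; d] ->
  exists t, (S = ab_pow a b t /\ c = a /\ d = b) \/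
            (S = ab_pow a b t ++ [:: a] /\ c = b /\ d = a).
Proof.
have [n] := ubnP (size S); elim: n => // n IHn in S * => szS.
case: S => [|e [|f S]] /= in szS *.
- by case=> -> ->; exists 0; left.
- by case=> -> -> ->; exists 0; right.
case=> <- <- /IHn[|t [[-> [-> ->]]|[-> [-> ->]]]]; first lia.
  by exists t.+1; left.
by exists t.+1; right.
Qed.

(** Two words that span in both orders satisfy S d = c' S' and c S = S' d',
    hence c' c S = S d d'. *)
Lemma alternating_span y1 y2 p c S d q c' S' d' :
  span y1 y2 p c S d q -> span y2 y1 p c' S' d' q ->
  [/\ c' != c, S ++ [:: d; d'] = c' :: S' ++ [:: d'] &
      exists t, (S = ab_pow c' c t /\ d = c' /\ d' = c) \/
                (S = ab_pow c' c t ++ [:: c'] /\ d = c /\ d' = c')].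
Proof.
move=> [-> -> h _] [/cat_injr e2 /cat_injr e1 _ _].
have {}e1 : S ++ [:: d] = c' :: S' by apply: (@cat_injl q); rewrite -catA.
have {}e2 : c :: S = S' ++ [:: d'].
  by apply: (@cat_injl q); rewrite -catA /= -e2.
have e3 : S ++ [:: d; d'] = c' :: S' ++ [:: d'].
  by rewrite -cat_cons -e1 -catA.
split=> //; first by case: (S) e1 h => [|s T] [<-].
by apply: alternating_ends; rewrite e3 e2.
Qed.

Definition affixed p q (U : {fset word}) : {fset word} :=
  [fset p ++ x ++ q | x in U]%fset.

Definition listed a b (V : {fset word}) : Prop :=
  (exists2 t : nat, 1 <= t & V = V1 a b t) \/
  (exists2 t : nat, 2 <= t & V = V2 a b t) \/
  (exists2 t : nat, 1 <= t & V = V3 a b t) \/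
  (exists t : nat, V = V4 a b t) \/
  (exists t : nat, V = V5 a b t) \/
  (exists2 t : nat, 1 <= t & V = V6 a b t).

Definition listed_up_to_affixes (W : {fset word}) : Prop :=
  exists a b (U V : {fset word}) p q p' q',
    [/\ a != b, listed a b V, W = affixed p q U & V = affixed p' q' U].

Lemma affixed4 p q x1 x2 x3 x4 :
  affixed p q [fset x1; x2; x3; x4]%fset =
  [fset p ++ x1 ++ q; p ++ x2 ++ q; p ++ x3 ++ q; p ++ x4 ++ q]%fset.
Proof. by rewrite /affixed !imfsetU !imfset_fset1. Qed.

Lemma affixed_nil (U : {fset word}) : affixed [::] [::] U = U.
Proof.
rewrite -[RHS]imfset_id; apply: eq_imfset => // x /=; by rewrite cats0.
Qed.

Lemma ab_powSr a b t : ab_pow a b t.+1 = ab_pow a b t ++ [:: a; b].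
Proof. by elim: t => //= t IHt; congr [:: a, b & _]. Qed.

Lemma ab_powC a b t : b :: ab_pow a b t ++ [:: a] = ab_pow b a t.+1.
Proof. by elim: t => //= t IHt; congr [:: b, a & _]. Qed.

Variable W : {fset word}.

(** Spans in the same order for z1 and z2 would give z1 = z2; spans in opposite
    orders force alternation, and the parity of the length of S separates the
    families V4 and V5. *)
Lemma listed_two_over_two y1 y2 z1 z2 :
  y1 <> y2 -> z1 <> z2 ->
  inserted y1 z1 -> inserted y2 z1 -> inserted y1 z2 -> inserted y2 z2 ->
  W =i [:: y1; y2; z1; z2] -> listed_up_to_affixes W.
Proof.
move=> ny nz i11 i21 i12 i22 eW.
have [p [c [S [d [q [ez1 o1]]]]]] := common_super ny i11 i21.
have [p' [c' [S' [d' [q' [ez2 s2]]]]]] := common_super ny i12 i22.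
wlog s1 : y1 y2 ny i11 i21 i12 i22 eW o1 s2 / span y1 y2 p c S d q.
  case: o1 => s1 H; first by apply: (H y1 y2) => //; left.
  apply: (H y2 y1) => //; try by [left|apply/nesym|right].
    by move=> w; rewrite eW !inE orbCA.
  by case: s2; [right|left].
case: s2 => s2.
  case: nz; have [? ? ? ? ?] := span_uniq s1 s2; subst p' c' S' d' q'.
  by rewrite ez1 ez2.
have [? ?] := span_affix_uniq_swap s1 s2; subst p' q'.
have [nab e [t H]] := alternating_span s1 s2.
have {e} ez2 : z2 = p ++ S ++ [:: d; d'] ++ q.
  by rewrite ez2 (catA S) e /= -!catA.
have [ey1 ey2 _ _] := s1.
case: H => -[eS [ed ed']]; subst d d'.
  exists c', c, (V4 c' c t), (V4 c' c t), p, q, [::], [::].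
  rewrite affixed_nil; split=> //; first by do 3!right; left; exists t.
  apply/fsetP=> w; rewrite eW affixed4 ey1 ey2 ez1 ez2 eS ab_powSr /= -!catA.
  by rewrite !inE; do 4 case: (w == _).
exists c', c, (V5 c' c t), (V5 c' c t), p, q, [::], [::].
rewrite affixed_nil; split=> //; first by do 4!right; left; exists t.
apply/fsetP=> w; rewrite eW affixed4 ey1 ey2 ez1 ez2 eS ab_powSr /= -!catA.
by rewrite !inE; do 4 case: (w == _).
Qed.

(** The four words are the vertices of p (1,c) S (1,d) q, which is valid exactly
    when c S and S d differ. *)
Definition no_square : Prop := forall p c S d q,
  p ++ S ++ q \in W -> p ++ c :: S ++ q \in W -> p ++ S ++ d :: q \in W ->
  p ++ c :: S ++ d :: q \in W -> c :: S = S ++ [:: d].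

(** When the subword x and the superword z come from spans of y1 and y2 in the
    same order, the four words are the vertices of a valid 2-block. Otherwise
    the words alternate: an S of even length gives V3, and one of odd length
    becomes V1 once a letter is put in front. *)
Lemma listed_chain x y1 y2 z :
  no_square -> y1 <> y2 ->
  inserted x y1 -> inserted x y2 -> inserted y1 z -> inserted y2 z ->
  W =i [:: x; y1; y2; z] -> listed_up_to_affixes W.
Proof.
move=> nosq ny i11 i21 i12 i22 eW.
have [p [c [S [d [q [ex o1]]]]]] := common_sub ny i11 i21.
have [p' [c' [S' [d' [q' [ez s2]]]]]] := common_super ny i12 i22.
wlog s1 : y1 y2 ny i11 i21 i12 i22 eW o1 s2 / span y1 y2 p c S d q.
  case: o1 => s1 H; first by apply: (H y1 y2) => //; left.
  apply: (H y2 y1) => //; try by [left|apply/nesym|right].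
    by move=> w; rewrite eW !inE; do 4 case: (w == _).
  by case: s2; [right|left].
case: s2 => s2.
  have [? ? ? ? ?] := span_uniq s1 s2; subst p' c' S' d' q'.
  have [ey1 ey2 h _] := s1.
  have /nosq : p ++ S ++ q \in W by rewrite eW -ex !inE eqxx.
  move=> /(_ c d); rewrite -ey1 -ey2 -ez !eW !inE !eqxx !orbT.
  move=> /(_ isT isT isT).
  by case: (S) h => [|s T] /= + [] => [/eqP|/eqP] // + e; case.
have [? ?] := span_affix_uniq_swap s1 s2; subst p' q'.
have [nab e [t H]] := alternating_span s1 s2.
have {e} ez : z = p ++ S ++ [:: d; d'] ++ q.
  by rewrite ez (catA S) e /= -!catA.
have [ey1 ey2 _ _] := s1.
case: H => -[eS [ed ed']]; subst d d'.
  exists c', c, (V3 c' c t), (V3 c' c t), p, q, [::], [::].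
  rewrite affixed_nil; split=> //.
    do 2!right; left; exists t => //; case: t eS => // eS.
    (* for empty S, the four words are the vertices of p (1,c') (1,c) q *)
    rewrite eS /= in ez ex ey1 ey2.
    have := nosq p c' [::] c q; rewrite -ex -ey1 -ey2 -ez !eW !inE !eqxx !orbT.
    by move=> /(_ isT isT isT isT) -[e]; rewrite e eqxx in nab.
  apply/fsetP=> w; rewrite eW affixed4 ex ey1 ey2 ez eS ab_powSr /= -!catA.
  by rewrite !inE; do 4 case: (w == _).
exists c, c', [fset S; c :: S; S ++ [:: c]; S ++ [:: c; c']]%fset.
exists (V1 c c' t.+1), p, q, [:: c], [::].
split=> //; first by rewrite eq_sym.
- by left; exists t.+1.
- apply/fsetP=> w; rewrite eW affixed4 ex ey1 ey2 ez /= -!catA.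
  by rewrite !inE; do 4 case: (w == _).
by rewrite affixed4 !cats0 /= eS /V1 (ab_powSr _ _ t.+1) -ab_powC /= -!catA.
Qed.

End WordCombinatorics.

(** * Blocks described by their vertices *)

Section BlocksByVertices.

Variable Sigma : finType.

Notation word := (seq Sigma).
Notation block := (block Sigma).

Implicit Types (x y : word) (s t : block) (P : pred nat) (W : {pred word}).

Lemma block_equiv_evalP s t : block_equiv s t <->
  dim s = dim t /\ forall P, eval P 0 s = eval P 0 t.
Proof.
rewrite /block_equiv; split=> [/andP[/eqP e]|[e E]].
  by move=> /(equiv_atP erefl (esym e)).
by rewrite e eqxx -e; apply/(equiv_atP erefl (esym e)).
Qed.

Lemma eval_canon P s : eval P 0 (canon s) = eval P 0 s.
Proof. by have /block_equiv_evalP[_ ->] := canon_equiv s. Qed.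

Lemma eq_canon s t : dim s = dim t -> (forall P, eval P 0 s = eval P 0 t) ->
  canon s = canon t.
Proof. by move=> e E; apply/canon_eqP/block_equiv_evalP. Qed.

Lemma canon_canon s : canon (canon s) = canon s.
Proof. exact/canon_id/canon_canonical. Qed.

Lemma gen_canon s : gen (canon s) = gen s.
Proof. by rewrite /gen canon_canon. Qed.

Lemma eval_ext P Q i s : (forall j, i <= j < i + dim s -> P j = Q j) ->
  eval P i s = eval Q i s.
Proof.
by move=> e; congr (_ ++ _); apply: eq_vertex_tail => j h1 h2; rewrite e ?h1.
Qed.

Lemma vertex_tail_pred1S i l : vertex_tail (pred1 i) i.+1 l =
  vertex_tail pred0 i.+1 l :> word.
Proof. by apply: eq_vertex_tail => j /gtn_eqF /= ->. Qed.

(** If a x = x b, then (1,a) x (1,b) is equivalent to two adjacent insertions of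
    one and the same symbol. *)
Definition separated (u v : Sigma * word) : bool := u.1 :: u.2 != rcons u.2 v.1.

(** The vertices that keep only the i-th or only the next insertion share
    everything except a x against x b. *)
Lemma sorted_separatedP k (l : seq (Sigma * word)) :
  reflect (forall i, i.+1 < size l ->
             vertex_tail (pred1 (k + i)) k l <>
             vertex_tail (pred1 (k + i.+1)) k l)
          (sorted separated l).
Proof.
elim: l k => [|[a x] [|[b y] l] IHl] k; try by left.
have eq0 : vertex_tail (pred1 k) k [:: (a, x), (b, y) & l] =
           (a :: x) ++ y ++ vertex_tail pred0 k.+2 l.
  rewrite /= eqxx gtn_eqF //=; congr (_ :: _ ++ _ ++ _).
  by apply: eq_vertex_tail => j /(ltn_trans (ltnSn _))/gtn_eqF /= ->.
have eq1 : vertex_tail (pred1 k.+1) k [:: (a, x), (b, y) & l] =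
           rcons x b ++ y ++ vertex_tail pred0 k.+2 l.
  by rewrite /= eqxx ltn_eqF //= cat_rcons vertex_tail_pred1S.
have eqS i : vertex_tail (pred1 (k + i.+1)) k [:: (a, x), (b, y) & l] =
             x ++ vertex_tail (pred1 (k.+1 + i)) k.+1 ((b, y) :: l).
  by rewrite -addSnnS /= ltn_eqF // addSn ltnS leq_addr.
rewrite [sorted _ _]/=; apply: (iffP andP) => [[/eqP ab /(IHl k.+1) H]|H].
  case=> [|i] il; last first.
    by rewrite !eqS => /eqP; rewrite eqseq_cat // eqxx => /eqP; apply: H.
  rewrite addn0 addn1 eq0 eq1 => /eqP; rewrite eqseq_cat ?size_rcons //.
  by move=> /andP[/eqP].
split.
  by apply/eqP => ab; apply: (H 0); rewrite ?addn0 ?addn1 ?eq0 ?eq1 ?ab.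
by apply/(IHl k.+1) => i il e; apply: (H i.+1 il); rewrite !eqS e.
Qed.

Definition separates_vertices s : Prop := forall i, i.+1 < dim s ->
  eval (pred1 i) 0 s <> eval (pred1 i.+1) 0 s.

Lemma sorted_separated_eval s :
  sorted separated s.2 <-> separates_vertices s.
Proof.
split=> [/(sorted_separatedP 0) H i il /eqP|H].
  by rewrite eqseq_cat // eqxx => /eqP; apply: H.
apply/(sorted_separatedP 0) => i il e; apply: (H i il).
by congr (_ ++ _).
Qed.

(** For a canonical block, a x = x b only happens when x is empty and a = b. The
    right-hand side depends on the vertices alone, so that validity is read off
    from any equivalent block, and is kept by every injective map of
    vertices. *)
Lemma validP s : valid s <-> separates_vertices s.
Proof.
have -> : valid s = sorted separated (canon s).2.
  rewrite /valid; have := canon_canonical s; rewrite /canonical.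
  elim: (canon s).2 => [|[a x] [|[b y] l] IHl] //= /andP[ax cl].
  congr (_ && _); last exact: IHl.
  case: x ax => [|c x] /=; first by rewrite /separated /= eqseq_cons andbT.
  rewrite /separated /= eqseq_cons => /negPf.
  by rewrite -[Some _ == _]/(c == a) eq_sym => ->.
rewrite sorted_separated_eval /separates_vertices dim_canon.
by split=> H i /H; rewrite !eval_canon.
Qed.

Lemma valid_separated s : valid s = sorted separated s.2.
Proof. by apply/idP/idP => /=; rewrite validP sorted_separated_eval. Qed.

Lemma in_CBP W s :
  in_CB W s <-> [/\ canonical s, valid s & forall P, eval P 0 s \in W].
Proof.
split=> -[cs vs H]; split=> //; last by move=> I; rewrite vertexE.
move=> P.
have -> : eval P 0 s = vertex [set j : 'I_(dim s) | P j] s.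
  rewrite vertexE //; apply: eval_ext => j /= js.
  by rewrite (holds_atE _ (Ordinal js)) inE.
exact: H.
Qed.

(** Membership in the complex up to equivalence: it drops canonicity, which
    faces need not inherit. *)
Definition in_class W s : Prop := valid s /\ forall P, eval P 0 s \in W.

Lemma valid_canon s : valid (canon s) = valid s.
Proof. by rewrite /valid canon_canon. Qed.

Lemma in_CB_canon W s : in_CB W (canon s) <-> in_class W s.
Proof.
rewrite in_CBP valid_canon; split=> [[_ v H]|[v H]].
  by split=> // P; rewrite -eval_canon.
split=> //; first exact: canon_canonical.
by move=> P; rewrite eval_canon.
Qed.

Definition face (top : bool) m (i : 'I_m) s : block :=
  subblock (if top then [set i] else set0) (if top then set0 else [set i]) s.

Lemma holds_at_set1 m (i : 'I_m) j : holds_at [set i] j = (j == i).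
Proof.
apply/existsP/eqP => [[k]|->]; last by exists i; rewrite inE !eqxx.
by rewrite inE => /andP[/eqP-> /eqP<-].
Qed.

(** The insertions of the i-th face are numbered with i skipped, whence
    unbump. *)
Definition with_bit (i : nat) (c : bool) P : pred nat :=
  fun j => if j == i then c else P (unbump i j).

Lemma face_spec (c : bool) m (i : 'I_m) s P : dim s = m ->
  (dim (face c i s)).+1 = m /\
  eval P 0 (face c i s) = eval (with_bit i c P) 0 s.
Proof.
case: s => x0 l; rewrite /face /eval /dim /=.
set A := if c then _ else _; set B := if c then _ else _.
have HA j : holds_at A j = c && (j == i).
  by rewrite /A; case: (c); rewrite ?holds_at0 ?holds_at_set1.
have HB j : holds_at B j = ~~ c && (j == i).
  by rewrite /B; case: (c); rewrite ?holds_at0 ?holds_at_set1.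
have after k (l' : seq (Sigma * word)) : i <= k ->
    size (subblock_tail A B k.+1 l').2 = size l' /\
    eval P k (subblock_tail A B k.+1 l') = vertex_tail (with_bit i c P) k.+1 l'.
  elim: l' k => [|[a x] l' IHl] k ik //=; rewrite HA HB gtn_eqF // !andbF /=.
  have [|sz ev] := IHl k.+1; first exact: leqW.
  rewrite sz; split=> //; rewrite -ev /eval /with_bit gtn_eqF //=.
  by rewrite /unbump ltnS ik subn1 /= -!catA.
have main k (l' : seq (Sigma * word)) : k <= i < k + size l' ->
    (size (subblock_tail A B k l').2).+1 = size l' /\
    eval P k (subblock_tail A B k l') = vertex_tail (with_bit i c P) k l'.
  elim: l' k => [|[a x] l' IHl] k /=; first by rewrite addn0; lia.
  case: (eqVneq k i) => [->|ki] kl.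
    have [sz ev] := after i l' (leqnn _).
    rewrite HA HB eqxx !andbT /with_bit eqxx.
    by case: (c) ev sz; rewrite /= /eval /= => <- ->; rewrite -?catA.
  have [|sz ev] := IHl k.+1; first lia.
  rewrite HA HB (negPf ki) !andbF /= sz; split=> //.
  rewrite -ev /eval /with_bit (negPf ki) /= -!catA.
  have ki0 : (i < k) = false by lia.
  by rewrite /unbump ki0 subn0.
move=> szl; have [|sz ev] := main 0 l; first by rewrite szl ltn_ord.
by rewrite sz -ev /eval -catA.
Qed.

Lemma dim_face c m (i : 'I_m) s : dim s = m -> (dim (face c i s)).+1 = m.
Proof. by move=> sm; have [] := @face_spec c m i s predT sm. Qed.

Lemma eval_face c m (i : 'I_m) s P : dim s = m ->
  eval P 0 (face c i s) = eval (with_bit i c P) 0 s.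
Proof. by move=> sm; have [] := @face_spec c m i s P sm. Qed.

Lemma valid_dim_le1 s : dim s <= 1 -> valid s.
Proof. by case: s => x0 [|[a x] [|? ?]]. Qed.

Lemma subblock_tail_id m (A B : {set 'I_m}) k (l : seq (Sigma * word)) :
  (forall j, k <= j -> ~~ holds_at A j /\ ~~ holds_at B j) ->
  subblock_tail A B k l = ([::], l).
Proof.
elim: l k => [|[a x] l IHl] k H //=.
have [/negPf-> /negPf->] := H k (leqnn k).
by rewrite IHl /= ?cats0 // => j /ltnW; apply: H.
Qed.

(** Keeping the symbol b of (1,a) y (1,b) x lengthens y to y b x; since a y and
    y b differ, so do longer words that start with them. *)
Lemma valid_upper_face m (i : 'I_m) s : valid s -> valid (face true i s).
Proof.
have step k c y (l : seq (Sigma * word)) :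
    let r := subblock_tail [set i] set0 k l in
    path separated (c, y) l -> path separated (c, y ++ r.1) r.2.
  elim: l k c y => [|[a x] l IHl] k c y //= /andP[cya pl].
  rewrite holds_at_set1 holds_at0; case: eqVneq => [->|_] /=; last first.
    by rewrite cats0; apply/andP; split; [exact: cya | exact: IHl].
  rewrite subblock_tail_id /= => [|j ij]; last first.
    by rewrite holds_at_set1 holds_at0 gtn_eqF.
  case: l pl {IHl} => [|[b z] l] //= /andP[_ ->]; rewrite andbT.
  apply: contra cya; rewrite /separated /= cats0 => e.
  have: (c :: y) ++ a :: x == rcons y a ++ rcons x b.
    by rewrite cat_rcons -rcons_cons -rcons_cat.
  by rewrite eqseq_cat ?size_rcons // => /andP[].
rewrite !valid_separated; case: s => x0 [|[a x] l] //= pl.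
rewrite holds_at_set1 holds_at0; case: eqVneq => [i0|_] /=; last exact: step.
rewrite subblock_tail_id /= => [|j ij]; last first.
  by rewrite holds_at_set1 holds_at0 -i0 gtn_eqF.
by case: l pl => [|? ?] //= /andP[].
Qed.

Lemma in_class_face W c m (i : 'I_m) s : dim s = m -> in_class W s ->
  (~~ c -> valid (face c i s)) -> in_class W (face c i s).
Proof.
move=> sm [vs Ws] vF; split=> [|P]; last by rewrite eval_face.
by case: c vF => [_|]; [apply: valid_upper_face | apply].
Qed.

End BlocksByVertices.

(** * Chains and chain maps induced by maps of words *)

Section Chains.

Local Open Scope ring_scope.

Variable Sigma : finType.

Notation word := (seq Sigma).
Notation block := (block Sigma).
Notation chain := (chain Sigma).

Implicit Types (s t : block) (z : chain) (h : block -> chain).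
Implicit Types (W V : {pred word}).

(** The linear extension to chains of a map on blocks; the boundary is one. *)
Definition extend h z : chain := \sum_(s <- msupp z) z@_s *: h s.

Lemma extendEw h (D : {fset block}) z : (msupp z `<=` D)%fset ->
  extend h z = \sum_(s <- D) z@_s *: h s.
Proof.
move=> le; rewrite [LHS](big_fset_incl _ le) // => s _ /mcoeff_outdom ->.
by rewrite scale0r.
Qed.

Fact extend_is_additive h : GRing.additive (extend h).
Proof.
move=> z1 z2; rewrite !(@extendEw h (msupp z1 `|` msupp z2)%fset).
- by rewrite -sumrB; apply: eq_bigr => s _; rewrite mcoeffB scalerBl.
- exact: fsubsetUr.
- exact: fsubsetUl.
exact: msuppB_le.
Qed.

HB.instance Definition _ h :=
  GRing.isZmodMorphism.Build chain chain (extend h) (extend_is_additive h).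

Lemma extend0 h : extend h 0 = 0.
Proof. exact: raddf0. Qed.

Lemma extendB h z1 z2 : extend h (z1 - z2) = extend h z1 - extend h z2.
Proof. exact: raddfB. Qed.

Lemma extendZ h (c : int) z : extend h (c *: z) = c *: extend h z.
Proof. by rewrite -(intz c) !scaler_int raddfMz. Qed.

Lemma extendU h s : extend h << s >> = h s.
Proof. by rewrite (extendEw _ msuppU_le) big_seq_fset1 mcoeffUU scale1r. Qed.

Lemma extend_gen h s : extend h (gen s) = h (canon s).
Proof. exact: extendU. Qed.

Lemma eq_extend h1 h2 z : {in msupp z, h1 =1 h2} -> extend h1 z = extend h2 z.
Proof.
by move=> e; rewrite /extend !big_seq; apply: eq_bigr => s /e ->.
Qed.

Lemma extend_extend h1 h2 z :
  extend h1 (extend h2 z) = extend (fun s => extend h1 (h2 s)) z.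
Proof.
by rewrite {2}/extend raddf_sum; apply: eq_bigr => s _; rewrite -extendZ.
Qed.

Lemma boundaryE : @boundary Sigma = extend (@boundary_block Sigma).
Proof. by []. Qed.

Lemma chain_sumE z : z = \sum_(s <- msupp z) z@_s *: << s >>.
Proof.
rewrite {1}[z]monalgE; apply: eq_bigr => s _; apply/malgP => t.
by rewrite mcoeffZ !mcoeffU mulr_natr.
Qed.

Section ChainsOf.

Variables (W : {pred word}) (k : nat).

Lemma is_chain0 : is_chain W k 0.
Proof. by move=> s; rewrite msupp0. Qed.

Lemma is_chainD z1 z2 : is_chain W k z1 -> is_chain W k z2 ->
  is_chain W k (z1 + z2).
Proof.
by move=> c1 c2 s /(fsubsetP (msuppD_le _ _)); rewrite inE => /orP[/c1|/c2].
Qed.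

Lemma is_chainZ (c : int) z : is_chain W k z -> is_chain W k (c *: z).
Proof. by move=> cz s /(fsubsetP (msuppZ_le _ _))/cz. Qed.

Lemma is_chainB z1 z2 : is_chain W k z1 -> is_chain W k z2 ->
  is_chain W k (z1 - z2).
Proof. by move=> c1 c2; rewrite -scaleN1r; apply/is_chainD/is_chainZ. Qed.

Lemma is_chain_sum I (r : seq I) (P : pred I) (F : I -> chain) :
  (forall i, P i -> is_chain W k (F i)) ->
  is_chain W k (\sum_(i <- r | P i) F i).
Proof.
by move=> H; apply: big_ind => //; [apply: is_chain0 | apply: is_chainD].
Qed.

Lemma is_chain_gen s : in_class W s -> dim s = k -> is_chain W k (gen s).
Proof.
move=> Ws sk t; rewrite /gen msuppU oner_eq0 inE => /eqP->.
by rewrite dim_canon; split=> //; apply/in_CB_canon.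
Qed.

Lemma is_chain_extend V h m z : is_chain V m z ->
  (forall s, in_CB V s -> dim s = m -> is_chain W k (h s)) ->
  is_chain W k (extend h z).
Proof.
move=> cz H; rewrite /extend big_seq; apply: is_chain_sum => s /cz[? ?].
by apply/is_chainZ/H.
Qed.

End ChainsOf.

Lemma boundaryB z1 z2 : boundary (z1 - z2) = boundary z1 - boundary z2.
Proof. exact: extendB. Qed.

Lemma boundaryZ (c : int) z : boundary (c *: z) = c *: boundary z.
Proof. exact: extendZ. Qed.

Lemma boundary_gen s : boundary (gen s) = boundary_block (canon s).
Proof. exact: extend_gen. Qed.

Lemma boundary0 : boundary 0 = 0 :> chain.
Proof. exact: extend0. Qed.

Lemma upper_faceE s (i : 'I_(dim s)) : upper_face i = gen (face true i s).
Proof. by []. Qed.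

Lemma lower_faceE s (i : 'I_(dim s)) :
  lower_face i = if valid (face false i s) then gen (face false i s) else 0.
Proof. by []. Qed.

Lemma is_chain_boundary_block W s :
  in_class W s -> is_chain W (dim s).-1 (boundary_block s).
Proof.
move=> Ws; apply: is_chain_sum => i _; apply/is_chainZ/is_chainB.
  apply: is_chain_gen; first exact: (@in_class_face _ _ true).
  by have /(congr1 predn) := @dim_face _ true _ i s erefl.
rewrite lower_faceE; case: ifP => v; last exact: is_chain0.
apply: is_chain_gen; first exact: (@in_class_face _ _ false).
by have /(congr1 predn) := @dim_face _ false _ i s erefl.
Qed.

Notation pushforward g := (extend (fun s => gen (g s))).

Section Transport.

Variables (W V : {pred word}) (f f' : word -> word) (g : block -> block).
Hypothesis fV : forall w, w \in W -> f w \in V.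
Hypothesis fK : {in W, cancel f f'}.
Hypothesis dim_g : forall s, in_CB W s -> dim (g s) = dim s.
Hypothesis eval_g :
  forall s, in_CB W s -> forall P, eval P 0 (g s) = f (eval P 0 s).

(** Validity compares vertices, and f is injective on the vertices concerned. *)
Lemma valid_transport s t : dim t = dim s ->
  (forall P, eval P 0 s \in W) -> (forall P, eval P 0 t = f (eval P 0 s)) ->
  valid t = valid s.
Proof.
move=> d Ws e; apply/idP/idP; rewrite !validP /separates_vertices d => H i il.
  by move=> E; apply: (H i il); rewrite !e E.
rewrite !e => /(congr1 f'); rewrite !fK //; exact: H.
Qed.

Lemma in_class_transport s : in_CB W s -> in_class V (g s).
Proof.
move=> Ws; have [_ vs e] := (in_CBP _ _).1 Ws.
split=> [|P]; last by rewrite eval_g //; apply: fV.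
by rewrite (valid_transport (dim_g Ws) e (eval_g Ws)).
Qed.

Lemma pushforward_gen s : in_class W s ->
  exists t, [/\ in_class V t, dim t = dim s,
     forall P, eval P 0 t = f (eval P 0 s) & pushforward g (gen s) = gen t].
Proof.
move=> /in_CB_canon Ws; exists (g (canon s)).
split; first exact: in_class_transport.
- by rewrite dim_g // dim_canon.
- by move=> P; rewrite eval_g // eval_canon.
by rewrite extend_gen.
Qed.

Lemma eq_gen s t : dim s = dim t -> (forall P, eval P 0 s = eval P 0 t) ->
  gen s = gen t.
Proof. by move=> d e; rewrite /gen (eq_canon d e). Qed.

(** Faces are determined by their vertices, so the faces of the image are the
    images of the faces; a lower face vanishes on both sides or on neither. *)
Lemma pushforward_boundary_block s t : in_class W s -> dim t = dim s ->
  (forall P, eval P 0 t = f (eval P 0 s)) ->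
  pushforward g (boundary_block s) = boundary_block t.
Proof.
move=> Ws d e; rewrite /boundary_block raddf_sum /=.
have push c (i : 'I_(dim s)) (j : 'I_(dim t)) : i = j :> nat ->
    in_class W (face c i s) ->
    pushforward g (gen (face c i s)) = gen (face c j t).
  move=> ij /pushforward_gen[u [_ du eu ->]]; apply: eq_gen => [|P].
    by apply: succn_inj; rewrite du !(@dim_face _ c) // d.
  by rewrite eu !eval_face // e /with_bit ij.
rewrite (reindex (cast_ord d)) /=; last first.
  by exists (cast_ord (esym d)) => i _; rewrite ?cast_ordK ?cast_ordKV.
apply: eq_bigr => i _; rewrite extendZ extendB; congr (_ *: (_ - _)).
  by apply: (push true) => //; apply: in_class_face.
have eV : valid (face false i t) = valid (face false (cast_ord d i) s).
  apply: valid_transport => [|P|P].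
  - by apply: succn_inj; rewrite !(@dim_face _ false) // d.
  - by rewrite eval_face //; case: Ws.
  by rewrite !eval_face // e.
rewrite !lower_faceE eV.
case: ifP => v; last exact: extend0.
by apply: (push false) => //; apply: in_class_face.
Qed.

Lemma is_chain_pushforward k z :
  is_chain W k z -> is_chain V k (pushforward g z).
Proof.
move=> /is_chain_extend; apply => s Ws sk; apply: is_chain_gen.
  exact: in_class_transport.
by rewrite dim_g.
Qed.

Lemma in_CB_class s : in_CB W s -> in_class W s.
Proof. by move=> /in_CBP[]. Qed.

Lemma pushforward_boundary k z : is_chain W k z ->
  pushforward g (boundary z) = boundary (pushforward g z).
Proof.
move=> cz; rewrite boundaryE !extend_extend; apply: eq_extend => s /cz[Ws _] /=.
rewrite extend_gen.
apply: pushforward_boundary_block; first exact: in_CB_class.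
  by rewrite dim_canon dim_g.
by move=> P; rewrite eval_canon eval_g.
Qed.

Lemma induced_by_pushforward : induced_by W V f (pushforward g).
Proof.
move=> s Ws; exists 1%g, (canon (g s)).
have dg : dim (canon (g s)) = dim s by rewrite dim_canon dim_g.
split=> //.
- exact/in_CB_canon/in_class_transport.
- move=> I; rewrite !vertexE // eval_canon eval_g //.
  congr (f (eval (holds_at _) _ _)).
  by apply/setP => i; apply/idP/imsetP => [iI|[j jI ->]];
    [exists i; rewrite ?perm1 | rewrite perm1].
rewrite odd_perm1 expr0 scale1r gen_canon extend_gen.
by rewrite canon_id //; case: Ws.
Qed.

End Transport.

Lemma pushforwardK W V f f' g g' k z :
  {in W, cancel f f'} -> (forall w, w \in W -> f w \in V) ->
  (forall s, in_CB W s -> dim (g s) = dim s) ->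
  (forall s, in_CB W s -> forall P, eval P 0 (g s) = f (eval P 0 s)) ->
  (forall s, in_CB V s -> dim (g' s) = dim s) ->
  (forall s, in_CB V s -> forall P, eval P 0 (g' s) = f' (eval P 0 s)) ->
  is_chain W k z -> pushforward g' (pushforward g z) = z.
Proof.
move=> fK fV dg eg dg' eg' cz.
rewrite extend_extend [RHS]chain_sumE; apply: eq_extend => s /cz[Ws _] /=.
rewrite extend_gen.
have [cs vs es] := (in_CBP _ _).1 Ws.
have Vg : in_CB V (canon (g s)).
  by apply/in_CB_canon; apply: (in_class_transport fV fK dg eg).
rewrite -[in RHS](canon_id cs); apply: eq_gen => [|P].
  by rewrite dg' // dim_canon dg.
by rewrite eg' // eval_canon eg // fK.
Qed.

Lemma chain_isomorphism_pushforward W V f f' g g' :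
  (forall w, w \in W -> f w \in V) -> (forall w, w \in V -> f' w \in W) ->
  {in W, cancel f f'} -> {in V, cancel f' f} ->
  (forall s, in_CB W s -> dim (g s) = dim s) ->
  (forall s, in_CB W s -> forall P, eval P 0 (g s) = f (eval P 0 s)) ->
  (forall s, in_CB V s -> dim (g' s) = dim s) ->
  (forall s, in_CB V s -> forall P, eval P 0 (g' s) = f' (eval P 0 s)) ->
  chain_isomorphism W V (pushforward g).
Proof.
move=> fV fW fK fK' dg eg dg' eg'; split=> [k z cz|k z cz z0|k z cz].
- split; first exact: (is_chain_pushforward fV fK dg eg).
  exact: (pushforward_boundary fV fK dg eg cz).
- have e := pushforwardK fK fV dg eg dg' eg' cz.
  exact: (etrans (esym e) (etrans (congr1 _ z0) (extend0 _))).
exists (pushforward g' z); first exact: (is_chain_pushforward fW fK' dg' eg').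
exact: (pushforwardK fK' fW dg' eg' dg eg cz).
Qed.

End Chains.

(** * Adding and removing affixes *)

Section Affixes.

Variable Sigma : finType.

Notation word := (seq Sigma).
Notation block := (block Sigma).

Implicit Types (p q x w : word) (s t : block) (P : pred nat).
Implicit Types (U W V : {fset word}).

Lemma vertex_tail_rcons P i l (a : Sigma) x :
  vertex_tail P i (rcons l (a, x)) =
  vertex_tail P i l ++ (if P (i + size l) then [:: a] else [::]) ++ x.
Proof.
elim: l i => [|[b y] l IHl] i /=; first by rewrite addn0 cats0.
by rewrite IHl addSnnS -!catA.
Qed.

Lemma eval_rcons P x0 l (a : Sigma) x :
  eval P 0 (x0, rcons l (a, x)) =
  eval P 0 (x0, l) ++ (if P (size l) then [:: a] else [::]) ++ x.
Proof. by rewrite /eval vertex_tail_rcons catA. Qed.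

Lemma add_affixes p q s : exists t,
  dim t = dim s /\ forall P, eval P 0 t = p ++ eval P 0 s ++ q.
Proof.
case: s => x0 l; case/lastP: l => [|l [a x]].
  by exists (p ++ x0 ++ q, [::]); split=> // P; rewrite /eval /= !cats0.
exists (p ++ x0, rcons l (a, x ++ q)); split=> [|P].
  by rewrite /dim /= !size_rcons.
by rewrite !eval_rcons /eval /= -!catA.
Qed.

Lemma valid_reflect (h : word -> word) s t : dim t = dim s ->
  (forall P, eval P 0 s = h (eval P 0 t)) -> valid s -> valid t.
Proof.
move=> d e /validP H; apply/validP => i il E; apply: (H i); first by rewrite -d.
by rewrite !e E.
Qed.

(** If the initial word is empty, the first insertion and everything behind it
    start with c, and validity prevents two adjacent insertions of c: hence
    x_1 starts with c, which commutes with the insertion. *)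
Lemma strip_head c s : valid s -> (forall P, exists w, eval P 0 s = c :: w) ->
  exists t, dim t = dim s /\ forall P, eval P 0 s = c :: eval P 0 t.
Proof.
case: s => -[|e x0] l; last first.
  by move=> _ /(_ predT)[w [<- _]]; exists (x0, l).
case: l => [|[a [|e x]] l]; first by move=> _ /(_ predT)[w].
  rewrite valid_separated /eval /= => vs H.
  have [_ [ac _]] := H predT; subst a.
  case: l => [|[b y] l] in vs H *; first by have [] := H pred0.
  (* the vertex that keeps only the second insertion starts with its symbol *)
  have [_ [bc _]] := H (pred1 1); move: vs.
  by rewrite /= bc /separated /= eqxx.
move=> _ H; have [_ [ac _]] := H predT; have [_ [ec _]] := H pred0; subst a e.
exists ([::], (c, x) :: l); split=> // P.
by rewrite /eval /=; case: (P 0).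
Qed.

(** Mirror image of the case of a first letter; the final c may have to be taken
    from the word in front of the last insertion. *)
Lemma strip_last c s :
  valid s -> (forall P, exists w, eval P 0 s = rcons w c) ->
  exists t, dim t = dim s /\ forall P, eval P 0 s = rcons (eval P 0 t) c.
Proof.
case: s => x0 l; case/lastP: l => [|l [a x]] vs H.
  have [w] := H predT; rewrite /eval cats0 /= => ->.
  by exists (w, [::]); split=> // P; rewrite !cats0.
case/lastP: x => [|x e] in vs H *; last first.
  have [w] := H predT; rewrite eval_rcons -!rcons_cat => /rcons_inj[_ ->].
  exists (x0, rcons l (a, x)); split=> [|P].
    by rewrite /dim /= !size_rcons.
  by rewrite !eval_rcons -!rcons_cat.
have [w] := H predT; rewrite eval_rcons cats0 cats1 => /rcons_inj[_ ac].
subst a; case/lastP: l => [|l [b y]] in vs H *.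
  have [w'] := H pred0; rewrite /eval !cats0 /= => ->.
  exists (w', [:: (c, [::])]); split=> // P.
  by rewrite /eval /= cats0; case: (P 0); rewrite ?cats0 ?cats1.
case/lastP: y => [|y e] in vs H *.
  have [w'] := H (pred1 (size l)).
  rewrite !eval_rcons size_rcons /= eqxx gtn_eqF // !cats0 cats1.
  move=> /rcons_inj[_ bc]; move: vs; rewrite valid_separated -!cats1 -catA bc.
  by move=> /= /cat_sorted2[_] /=; rewrite /separated /= eqxx.
have [w'] := H pred0; rewrite !eval_rcons /= cats0 -rcons_cat.
move=> /rcons_inj[_ ->].
exists (x0, rcons (rcons l (b, y)) (c, [::])); split=> [|P].
  by rewrite /dim /= !size_rcons.
rewrite !eval_rcons !size_rcons !cats0 -!rcons_cat.
by case: (P (size l).+1); rewrite ?cats0 ?cats1 -?rcons_cat.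
Qed.

Lemma strip_prefix p s : valid s -> (forall P, exists w, eval P 0 s = p ++ w) ->
  exists t, dim t = dim s /\ forall P, eval P 0 s = p ++ eval P 0 t.
Proof.
elim: p s => [|c p IHp] s vs H; first by exists s.
have [|t [dt et]] := @strip_head c s vs.
  by move=> P; have [w ->] := H P; exists (p ++ w).
have [||u [du eu]] := IHp t.
- exact: valid_reflect et vs.
- by move=> P; have [w] := H P; rewrite et => -[->]; exists w.
by exists u; split=> [|P]; rewrite ?du // et eu.
Qed.

Lemma strip_suffix q s : valid s -> (forall P, exists w, eval P 0 s = w ++ q) ->
  exists t, dim t = dim s /\ forall P, eval P 0 s = eval P 0 t ++ q.
Proof.
elim/last_ind: q s => [|q c IHq] s vs H.
  by exists s; split=> // P; rewrite cats0.
have [|t [dt et]] := @strip_last c s vs.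
  by move=> P; have [w ->] := H P; exists (w ++ q); rewrite rcons_cat.
have [||u [du eu]] := IHq t.
- exact: (@valid_reflect (rcons^~ c)) et vs.
- move=> P; have [w] := H P; rewrite et -rcons_cat => /rcons_inj[->].
  by exists w.
by exists u; split=> [|P]; rewrite ?du // et eu rcons_cat.
Qed.

Lemma strip_affixes p q s : valid s ->
  (forall P, exists x, eval P 0 s = p ++ x ++ q) ->
  exists t, dim t = dim s /\ forall P, eval P 0 s = p ++ eval P 0 t ++ q.
Proof.
move=> vs H; have [|t [dt et]] := @strip_prefix p s vs.
  by move=> P; have [x ->] := H P; exists (x ++ q).
have [||u [du eu]] := @strip_suffix q t.
- exact: valid_reflect et vs.
- move=> P; have [x] := H P; rewrite et => /cat_injr ->; by exists x.
by exists u; split=> [|P]; rewrite ?du // et eu.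
Qed.

Definition strip p q w : word :=
  take (size w - size p - size q) (drop (size p) w).

Lemma stripK p q x : strip p q (p ++ x ++ q) = x.
Proof.
rewrite /strip drop_size_cat // !size_cat addKn addnK take_size_cat //.
Qed.

Definition reaffix p q p' q' w : word := p' ++ strip p q w ++ q'.

Lemma reaffixE p q p' q' x : reaffix p q p' q' (p ++ x ++ q) = p' ++ x ++ q'.
Proof. by rewrite /reaffix stripK. Qed.

Lemma affixedP p q U w :
  reflect (exists2 x, x \in U & w = p ++ x ++ q) (w \in affixed p q U).
Proof. exact: imfsetP. Qed.

(** Vertices determine a block up to equivalence, so any block with the right
    vertices will do. *)
Definition lift_block (f : word -> word) s : block :=
  epsilon (inhabits s)
    (fun t => dim t = dim s /\ forall P, eval P 0 t = f (eval P 0 s)).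

Lemma lift_reaffix p q p' q' U s (t := lift_block (reaffix p q p' q') s) :
  in_CB (mem (affixed p q U)) s ->
  dim t = dim s /\ forall P, eval P 0 t = reaffix p q p' q' (eval P 0 s).
Proof.
move=> /in_CBP[_ vs sU].
suff E : exists t, dim t = dim s /\
    forall P, eval P 0 t = reaffix p q p' q' (eval P 0 s).
  exact: (epsilon_spec (inhabits s) _ E).
have [|u [du eu]] := @strip_affixes p q s vs.
  by move=> P; have /affixedP[x _ ->] := sU P; exists x.
have [t' [dt et]] := add_affixes p' q' u.
by exists t'; split=> [|P]; rewrite ?dt // et eu reaffixE.
Qed.

Lemma word_bijection_reaffix p q p' q' U :
  word_bijection (affixed p q U) (affixed p' q' U) (reaffix p q p' q').
Proof.
apply: (word_bij_elem (elem_affixes p' q')).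
apply: (@word_bij_inv _ (affixed p q U) U id _ (strip p q) (elem_affixes p q)).
  exact: word_bij_id.
by move=> x _; apply: stripK.
Qed.

Lemma isomorphic_reaffix p q p' q' U :
  isomorphic_via_words (affixed p q U) (affixed p' q' U).
Proof.
have V p1 q1 p2 q2 w :
    w \in affixed p1 q1 U -> reaffix p1 q1 p2 q2 w \in affixed p2 q2 U.
  by move=> /affixedP[x xU ->]; rewrite reaffixE; apply/affixedP; exists x.
have K p1 q1 p2 q2 :
    {in affixed p1 q1 U, cancel (reaffix p1 q1 p2 q2) (reaffix p2 q2 p1 q1)}.
  by move=> w /affixedP[x _ ->]; rewrite reaffixE stripK.
pose f := reaffix p q p' q'; pose f' := reaffix p' q' p q.
exists f; split; first exact: word_bijection_reaffix.
have L p1 q1 p2 q2 s (Us : in_CB (mem (affixed p1 q1 U)) s) :=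
  lift_reaffix p2 q2 Us.
exists (extend (fun s => gen (lift_block f s))); split.
  apply: (@chain_isomorphism_pushforward _ (mem (affixed p q U))
    (mem (affixed p' q' U)) f f' (lift_block f) (lift_block f')).
  - exact: V.
  - exact: V.
  - exact: K.
  - exact: K.
  - by move=> s /(L _ _ p' q')[].
  - by move=> s /(L _ _ p' q')[].
  - by move=> s /(L _ _ p q)[].
  - by move=> s /(L _ _ p q)[].
apply: (@induced_by_pushforward _ (mem (affixed p q U))
  (mem (affixed p' q' U)) f f' (lift_block f)).
- exact: V.
- exact: K.
- by move=> s /(L _ _ p' q')[].
- by move=> s /(L _ _ p' q')[].
Qed.

End Affixes.

(** * First homology of four words *)

Section FirstHomology.

Local Open Scope ring_scope.

Variable Sigma : finType.

Notation word := (seq Sigma).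
Notation block := (block Sigma).
Notation chain := (chain Sigma).

Implicit Types (x y : word) (s t e : block) (z : chain) (P : pred nat).

Definition lo s : word := eval pred0 0 s.
Definition hi s : word := eval predT 0 s.

Lemma eval_dim1 s P : dim s = 1%N -> eval P 0 s = if P 0%N then hi s else lo s.
Proof.
by case: s => x0 [|[a x1] [|? ?]] // _; rewrite /hi /lo /eval /=; case: (P 0%N).
Qed.

Lemma eval_dim2 s P Q : dim s = 2 -> P 0%N = Q 0%N -> P 1%N = Q 1%N ->
  eval P 0 s = eval Q 0 s.
Proof. by move=> ds e0 e1; apply: eval_ext; rewrite ds => -[|[]]. Qed.

Lemma inserted_lo_hi s : dim s = 1%N -> inserted (lo s) (hi s).
Proof.
case: s => x0 [|[a x1] [|? ?]] // _; rewrite /lo /hi /eval /= cats0.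
by exists x0, a, x1.
Qed.

(** The graph of 1-blocks is simple. *)
Lemma edge_inj s t : canonical s -> canonical t -> dim s = 1%N -> dim t = 1%N ->
  lo s = lo t -> hi s = hi t -> s = t.
Proof.
move=> cs ct ds dt el eh; apply: canonical_uniq => //.
apply/block_equiv_evalP; rewrite ds dt; split=> // P.
by rewrite !eval_dim1 ?el ?eh.
Qed.

Definition point x : chain := << word_block x >>.

Lemma gen_point P s : dim s = 0%N -> gen s = point (eval P 0 s).
Proof. by case: s => x [|? ?] // _; rewrite /gen /canon /eval /= !cats0. Qed.

Lemma boundary_edge s : dim s = 1%N ->
  boundary_block s = point (hi s) - point (lo s).
Proof.
move=> ds; have i0 : 'I_(dim s) by rewrite ds; apply: ord0.
have ei (i : 'I_(dim s)) : i = 0%N :> nat.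
  by have := ltn_ord i; rewrite [X in (_ < X)%N]ds; case: (nat_of_ord i).
have df c (i : 'I_(dim s)) : dim (face c i s) = 0%N.
  by apply: succn_inj; rewrite dim_face.
rewrite /boundary_block (bigD1 i0) //= big1 ?addr0 => [|i]; last first.
  by case/eqP; apply/val_inj; rewrite /= !ei.
have vf : valid (face false i0 s) by apply: valid_dim_le1; rewrite df.
rewrite (ei i0) expr0 scale1r upper_faceE lower_faceE vf.
rewrite (gen_point predT (df true i0)) (gen_point pred0 (df false i0)).
rewrite (eval_face true i0 predT erefl) (eval_face false i0 pred0 erefl).
by rewrite !(eval_dim1 _ ds) /with_bit (ei i0).
Qed.

Lemma boundary_gen_edge s : dim s = 1%N ->
  boundary (gen s) = point (hi s) - point (lo s).
Proof.
move=> ds.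
rewrite boundary_gen (boundary_edge (etrans (dim_canon s) ds)).
by rewrite /hi /lo !eval_canon.
Qed.

Definition joins s x y : Prop := lo s = x /\ hi s = y \/ lo s = y /\ hi s = x.

Definition linked z x y : Prop := exists2 s, s \in msupp z & joins s x y.

Lemma linked_sym z x y : linked z x y -> linked z y x.
Proof. by move=> [s sz [?|?]]; exists s => //; [right|left]. Qed.

Section Cycles.

Variables (W : {fset word}) (z : chain).
Hypotheses (cz : is_chain (mem W) 1 z) (bz : boundary z = 0).

Lemma dim_supp s : s \in msupp z -> dim s = 1%N.
Proof. by case/cz. Qed.

Lemma canonical_supp s : s \in msupp z -> canonical s.
Proof. by case/cz => -[]. Qed.

Lemma linked_in x y : linked z x y -> (x \in W) && (y \in W).
Proof.
move=> [s /cz[/in_CBP[_ _ sW] _]].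
have := sW pred0; have := sW predT; rewrite -/(lo s) -/(hi s) => hW lW.
by move=> [] [<- <-]; apply/andP; split.
Qed.

Lemma linked_inserted x y : linked z x y -> inserted x y \/ inserted y x.
Proof.
by move=> [s /dim_supp/inserted_lo_hi si [] [<- <-]]; [left|right].
Qed.

Lemma linked_odd x y : linked z x y -> odd (size y) = ~~ odd (size x).
Proof. by move=> /linked_inserted[] /size_inserted -> /=; rewrite ?negbK. Qed.

Lemma joins_inj s t x y : s \in msupp z -> canonical t -> dim t = 1%N ->
  joins s x y -> joins t x y -> s = t.
Proof.
move=> sz ct dt; have ds := dim_supp sz; have cs := canonical_supp sz.
have := size_inserted (inserted_lo_hi ds).
have := size_inserted (inserted_lo_hi dt).
move=> szt szs [] [lx hy] [] [lx' hy']; try (by apply: edge_inj; congruence).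
all: by move: szs szt; rewrite lx hy lx' hy'; lia.
Qed.

Lemma coeff_boundary x : (boundary z)@_(word_block x) =
  \sum_(s <- msupp z) z@_s * ((hi s == x)%:R - (lo s == x)%:R).
Proof.
rewrite /boundary raddf_sum !big_seq; apply: eq_bigr => s /dim_supp ds /=.
rewrite mcoeffZ boundary_edge // mcoeffB !mcoeffU.
have E (w : word) : (word_block w == word_block x) = (w == x).
  by apply/eqP/eqP => [[]|->].
by rewrite !E.
Qed.

(** In a cycle the coefficients of the edges at x cancel, so no vertex is an end
    of the support. *)
Lemma linked_other x y : linked z x y -> exists2 y', y' <> y & linked z x y'.
Proof.
move=> [s sz sxy].
have [/hasP[t tz /andP[ts /orP tx]]|/hasPn no] :=
  boolP (has (fun t => (t != s) && ((lo t == x) || (hi t == x))) (msupp z)).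
  have [y' txy'] : exists y', joins t x y'.
    by case: tx => /eqP tx; [exists (hi t); left | exists (lo t); right].
  exists y'; last by exists t.
  move=> ey; subst y'; case/eqP: ts; apply/esym.
  by apply: joins_inj sxy txy'; [| exact: canonical_supp | exact: dim_supp].
have := coeff_boundary x; rewrite bz mcoeff0 (big_fsetD1 s) //= big1_fset.
  rewrite addr0 => /esym/eqP; rewrite mulf_eq0 mcoeff_eq0 sz /=.
  have := size_inserted (inserted_lo_hi (dim_supp sz)).
  case: sxy => -[-> ->]; rewrite eqxx; case: (y =P x) => [->|_ _].
  - by move=> /n_Sn.
  - by [].
  - by move=> /n_Sn.
  by [].
move=> t; rewrite !inE => /andP[ts tz] _.
have := no t tz; rewrite ts /= negb_or => /andP[/negPf-> /negPf->].
by rewrite subrr mulr0.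
Qed.

(** Lengths change parity along each edge, so a walk that never turns back
    visits four different words, which exhaust W, and closes up there. *)
Lemma four_cycle : #|` W| = 4%N -> z != 0 ->
  exists u0 u1 u2 u3,
    [/\ linked z u0 u1, linked z u1 u2, linked z u2 u3 & linked z u3 u0] /\
    [/\ W =i [:: u0; u1; u2; u3], u0 <> u2 & u1 <> u3].
Proof.
move=> W4 z0; have /fset0Pn[s sz] : msupp z != fset0.
  by apply: contra_neq z0 => e; rewrite (chain_sumE z) e big_seq_fset0.
have l01 : linked z (lo s) (hi s) by exists s => //; left.
set u0 := lo s in l01; set u1 := hi s in l01.
have [u2 n20 l12] := linked_other (linked_sym l01).
have [u3 n31 l23] := linked_other (linked_sym l12).
have [u4 n42 l34] := linked_other (linked_sym l23).
have [o1 o2] := (linked_odd l01, linked_odd l12).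
have [o3 o4] := (linked_odd l23, linked_odd l34).
have neq x y : odd (size x) = ~~ odd (size y) -> (x == y) = false.
  by move=> o; apply/eqP => e; move: o; rewrite e; case: odd.
have /andP[W0 W1] := linked_in l01; have /andP[_ W2] := linked_in l12.
have /andP[W3 W4'] := linked_in l34.
have uq : uniq [:: u0; u1; u2; u3].
  rewrite /= !inE !negb_or !andbT; apply/and3P; split.
  - rewrite (neq u0 u1) ?(neq u0 u3) ?o3 ?o2 ?o1 ?negbK // andbT /=.
    by rewrite eq_sym; apply/eqP.
  - rewrite (neq u1 u2) ?o2 ?negbK //=; by rewrite eq_sym; apply/eqP.
  by rewrite (neq u2 u3) ?o3 ?negbK.
have [||_ eW] := uniq_min_size uq (s2 := enum_fset W).
  by move=> w; rewrite !inE => /or4P[] /eqP->.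
  by rewrite W4.
have : u4 \in [:: u0; u1; u2; u3] by rewrite eW.
rewrite !inE (neq u4 u1) ?(neq u4 u3) ?o4 ?o3 ?o2 ?negbK // !orbF /=.
case/orP => /eqP e4 //; subst u4.
exists u0, u1, u2, u3; do 2 split=> //; try exact/nesym.
Qed.

(** The 4-cycle already contains every pair of words of opposite parity. *)
Lemma full_support s : #|` W| = 4%N -> z != 0 ->
  in_CB (mem W) s -> dim s = 1%N -> s \in msupp z.
Proof.
move=> W4 z0 /in_CBP[cs _ sW] ds.
have [u0 [u1 [u2 [u3 [[l01 l12 l23 l30] [eW _ _]]]]]] := four_cycle W4 z0.
suff [t tz txy] : linked z (lo s) (hi s).
  by rewrite -(joins_inj tz cs ds txy) //; left.
have lW : lo s \in [:: u0; u1; u2; u3] by rewrite -eW; apply: sW.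
have hW : hi s \in [:: u0; u1; u2; u3] by rewrite -eW; apply: sW.
have := congr1 odd (size_inserted (inserted_lo_hi ds)).
have [[o1 o2] o3] := (linked_odd l01, linked_odd l12, linked_odd l23).
rewrite !inE in lW hW; case/or4P: lW => /eqP->; case/or4P: hW => /eqP->;
  rewrite /= ?o3 ?o2 ?o1 ?negbK => o //; try exact: linked_sym.
all: by move: o; case: odd.
Qed.

End Cycles.

Section Square.

Variables (W : {fset word}) (s : block).
Hypotheses (W4 : #|` W| = 4%N) (Ws : in_CB (mem W) s) (ds : dim s = 2).

Lemma alternating_square (V : zmodType) (A B C D : V) :
  A - B - (C - D) - (A - C - (B - D)) = 0.
Proof.
apply/eqP; rewrite subr_eq0; apply/eqP.
by rewrite !opprB addrACA [- B - C]addrC -addrACA.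
Qed.

Lemma boundary_alternating z1 z2 z3 z4 : boundary (z1 - z2 - (z3 - z4)) =
  boundary z1 - boundary z2 - (boundary z3 - boundary z4) :> chain.
Proof. by rewrite !boundaryB. Qed.

Lemma coeff_alternating z1 z2 z3 z4 e : (z1 - z2 - (z3 - z4))@_e =
  z1@_e - z2@_e - (z3@_e - z4@_e).
Proof. by rewrite !mcoeffB. Qed.

(** Lower faces of a 2-block are 1-blocks, hence valid. *)
Lemma boundary_square (i0 i1 : 'I_(dim s)) :
  i0 = 0%N :> nat -> i1 = 1%N :> nat ->
  boundary_block s =
    (gen (face true i0 s) - gen (face false i0 s)) -
    (gen (face true i1 s) - gen (face false i1 s)).
Proof.
move=> e0 e1.
have E (i : 'I_(dim s)) : upper_face i - lower_face i =
    gen (face true i s) - gen (face false i s).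
  have vf : valid (face false i s).
    by apply: valid_dim_le1; rewrite -ltnS (dim_face _ _ erefl) ds.
  by rewrite upper_faceE lower_faceE vf.
have i10 : i1 != i0 by rewrite -val_eqE /= e0 e1.
pose F (i : 'I_(dim s)) := (-1) ^+ i *: (upper_face i - lower_face i).
have -> : boundary_block s = F i0 + F i1.
  rewrite /boundary_block (bigD1 i0 isT) (bigD1 i1 i10) big1 => [|i].
    by congr (_ + _); apply: addr0.
  move=> /andP[]; rewrite -!val_eqE /= e0 e1 => n0 n1.
  have := ltn_ord i; rewrite [X in (_ < X)%N]ds.
  by move: n0 n1; case: (val i) => [|[]].
by rewrite /F !E e0 e1 expr0 expr1 scale1r scaleN1r.
Qed.

(** The chosen edge is the upper face at the first insertion; validity separates
    its lower end from that of the opposite edge. *)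
Lemma square_boundary : exists2 e, in_CB (mem W) e /\ dim e = 1%N &
  boundary (boundary_block s) = 0 /\ (boundary_block s)@_e = 1.
Proof.
have sW := in_CB_class Ws; have [vs _] := sW.
have lt0 : (0 < dim s)%N by rewrite ds.
have lt1 : (1 < dim s)%N by rewrite ds.
pose i0 := Ordinal lt0; pose i1 := Ordinal lt1.
rewrite (@boundary_square i0 i1 erefl erefl).
have df c (i : 'I_(dim s)) : dim (face c i s) = 1%N.
  by apply: succn_inj; rewrite (dim_face _ _ erefl).
have lo_f c (i : 'I_(dim s)) : lo (face c i s) = eval (with_bit i c pred0) 0 s.
  exact: (eval_face c i pred0 erefl).
have hi_f c (i : 'I_(dim s)) : hi (face c i s) = eval (with_bit i c predT) 0 s.
  exact: (eval_face c i predT erefl).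
have hi0 : hi (face true i0 s) = hi (face true i1 s).
  by rewrite !hi_f; apply: eval_dim2.
have hi1 : hi (face false i0 s) = lo (face true i1 s).
  by rewrite hi_f lo_f; apply: eval_dim2.
have hi2 : hi (face false i1 s) = lo (face true i0 s).
  by rewrite hi_f lo_f; apply: eval_dim2.
have lo1 : lo (face false i0 s) = lo (face false i1 s).
  by rewrite !lo_f; apply: eval_dim2.
have lo2 : lo (face true i1 s) <> lo (face true i0 s).
  have /validP /(_ 0%N lt1) n := vs; rewrite !lo_f => e; apply: n.
  transitivity (eval (with_bit i0 true pred0) 0 s).
    by apply: eval_dim2.
  by rewrite -e; apply: eval_dim2.
have lo3 : lo (face false i1 s) <> lo (face true i0 s).
  move=> /(congr1 size).
  rewrite -hi2 (size_inserted (inserted_lo_hi (df false i1))).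
  exact: n_Sn.
exists (canon (face true i0 s)).
  rewrite dim_canon df; split=> //; apply/in_CB_canon.
  by apply: in_class_face.
split.
  rewrite boundary_alternating !(boundary_gen_edge (df _ _)) hi0 hi1 hi2 lo1.
  exact: alternating_square.
rewrite coeff_alternating /gen !mcoeffU eqxx.
have ne c (i : 'I_(dim s)) : lo (face c i s) <> lo (face true i0 s) ->
    (canon (face c i s) == canon (face true i0 s)) = false.
  move=> n; apply/eqP => /(congr1 lo); rewrite /lo !eval_canon; exact: n.
by rewrite !ne ?subr0 // lo1.
Qed.

(** Subtracting a multiple of the boundary of the square removes one edge from
    the support of a cycle; as nonzero cycles have full support, nothing is
    left. *)
Lemma square_homology : homology_is_zero (mem W) 1.
Proof.
move=> z cz bz; have [e [We de] [bb be]] := square_boundary.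
have cb : is_chain (mem W) 1 (boundary_block s).
  by have := is_chain_boundary_block (in_CB_class Ws); rewrite ds.
exists (z@_e *: gen s).
  by apply/is_chainZ/is_chain_gen => //; apply: in_CB_class.
rewrite boundaryZ boundary_gen canon_id; last by case: Ws.
apply/esym/eqP; rewrite -subr_eq0; apply/negPn/negP => nz.
have cz' : is_chain (mem W) 1 (z - z@_e *: boundary_block s).
  by apply/is_chainB/is_chainZ.
have bz' : boundary (z - z@_e *: boundary_block s) = 0.
  by rewrite boundaryB boundaryZ bz bb scaler0 subr0.
have := full_support cz' bz' W4 nz We de.
by rewrite -mcoeff_neq0 mcoeffB mcoeffZ be mulr1 subrr eqxx.
Qed.

End Square.

Lemma nonzero_homology_no_square (W : {fset word}) : #|` W| = 4%N ->
  ~ homology_is_zero (mem W) 1 -> no_square W.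
Proof.
move=> W4 nH p c S d q W0 W1 W2 W3; apply/eqP/negPn/negP => n.
pose s : block := (p, [:: (c, S); (d, q)]).
have Ws : in_class (mem W) s.
  split; first by rewrite valid_separated /= andbT /separated /= -cats1.
  move=> P; rewrite /eval /= !cats0.
  by case: (P 0%N); case: (P 1%N).
by case: nH; apply: (@square_homology W (canon s)); rewrite ?dim_canon //;
  apply/in_CB_canon.
Qed.

(** The four links go up or down in length and add up to zero: either one word
    is below and one above the two others, or two words are below the other
    two. *)
Lemma nonzero_homology_listed (W : {fset word}) : #|` W| = 4%N ->
  ~ homology_is_zero (mem W) 1 -> listed_up_to_affixes W.
Proof.
move=> W4 nH; have nosq := nonzero_homology_no_square W4 nH.
have [//|no] := classic (listed_up_to_affixes W).
case: nH => z cz bz; have [->|nz] := eqVneq z 0.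
  by exists 0; [apply: is_chain0 | rewrite boundary0].
case: no; have [u0 [u1 [u2 [u3 [[l01 l12 l23 l30] [eW n02 n13]]]]]] :=
  four_cycle cz bz W4 nz.
have ins x y (l : linked z x y) := linked_inserted cz l.
have chain (u v w t : word) : W =i [:: u; v; w; t] -> v <> t -> inserted u v ->
    inserted v w -> inserted t w -> inserted u t -> listed_up_to_affixes W.
  move=> e n uv vw tw ut; apply: (listed_chain nosq n uv ut vw tw).
  by move=> r; rewrite e !inE; do 4 case: (r == _).
have zigzag (u v w t : word) : W =i [:: u; v; w; t] -> u <> w -> v <> t ->
    inserted u v -> inserted w v -> inserted w t -> inserted u t ->
    listed_up_to_affixes W.
  move=> e n n' uv wv wt ut; apply: (listed_two_over_two n n' uv wv ut wt).
  by move=> r; rewrite e !inE; do 4 case: (r == _).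
have rotate (u v w t : word) : W =i [:: u; v; w; t] -> W =i [:: v; w; t; u].
  by move=> e r; rewrite e !inE; do 4 case: (r == _).
have eW1 := rotate _ _ _ _ eW; have eW2 := rotate _ _ _ _ eW1.
have eW3 := rotate _ _ _ _ eW2.
have [n20 n31] := (nesym n02, nesym n13).
case: (ins _ _ l01) => i01; have s01 := size_inserted i01;
  case: (ins _ _ l12) => i12; have s12 := size_inserted i12;
  case: (ins _ _ l23) => i23; have s23 := size_inserted i23;
  case: (ins _ _ l30) => i30; have s30 := size_inserted i30; try lia.
- exact: (chain u0 u1 u2 u3).
- exact: (zigzag u0 u1 u2 u3).
- exact: (chain u3 u0 u1 u2).
- exact: (chain u1 u2 u3 u0).
- exact: (zigzag u1 u2 u3 u0).
- exact: (chain u2 u3 u0 u1).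
Qed.

End FirstHomology.

Theorem theorem5p1 (Sigma : finType) (W : {fset seq Sigma}) :
  #|` W| = 4 ->
  ~ homology_is_zero (mem W) 1 ->
  exists (a b : Sigma) (V : {fset seq Sigma}),
    [/\ a != b,
        (exists2 t : nat, 1 <= t & V = V1 a b t) \/
        (exists2 t : nat, 2 <= t & V = V2 a b t) \/
        (exists2 t : nat, 1 <= t & V = V3 a b t) \/
        (exists t : nat, V = V4 a b t) \/
        (exists t : nat, V = V5 a b t) \/
        (exists2 t : nat, 1 <= t & V = V6 a b t)
      & isomorphic_via_words W V].
Proof.
move=> W4 nH.
have [a [b [U [V [p [q [p' [q' [nab lV eW eV]]]]]]]]] :=
  nonzero_homology_listed W4 nH.
exists a, b, V; split=> //; rewrite eW eV; exact: isomorphic_reaffix.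
Qed.
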